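(* Let $G=\mathrm{Hei}\rtimes\mathbb{Z}/4$ act on the real Heisenberg group $\mathrm{Hei}(\mathbb{R})$ as described in the context. The manifold $\mathrm{Hei}(\mathbb{R})$ with this $G$-action is a model for $\underline{E}G$. The quotient space $G\backslash\underline{E}G$ is homeomorphic to $S^3$.
   Context: $\mathrm{Hei}(\mathbb{R})$ is the Lie group of real $(3,3)$-matrices $\begin{pmatrix}1&x&y\\0&1&z\\0&0&1\end{pmatrix}$, identified with $\mathbb{R}^3$ via $(x,y,z)$, with multiplication $(a,b,c)\bullet(x,y,z)=(a+x,\,b+y+az,\,c+z)$. The discrete Heisenberg group $\mathrm{Hei}$ is the subgroup of elements with integer entries; it acts on $\mathrm{Hei}(\mathbb{R})$ by left multiplication. The generator $t$ of $\mathbb{Z}/4$ acts on $\mathrm{Hei}(\mathbb{R})$ by the Lie group automorphism $(x,y,z)\mapsto(-z,\,y-xz,\,x)$, which restricts to an automorphism of $\mathrm{Hei}$. $G=\mathrm{Hei}\rtimes\mathbb{Z}/4$ is the corresponding semi-direct product, and the two actions fit together to a $G$-action on $\mathrm{Hei}(\mathbb{R})$. $\underline{E}G$, the classifying space for proper $G$-actions, is a $G$-CW-complex with finite isotropy groups whose $H$-fixed point set is contractible for each finite subgroup $H\subseteq G$; it is unique up to $G$-homotopy equivalence. *)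

(* Defs.v *)
From HB Require Import structures.
From mathcomp Require Import all_boot all_order all_algebra.
From mathcomp Require Import generic_quotient ring.
From mathcomp Require Import all_classical all_reals all_analysis.

Set Implicit Arguments.
Unset Strict Implicit.
Unset Printing Implicit Defensive.

Import Order.TTheory GRing.Theory Num.Theory.
Import numFieldNormedType.Exports.

Local Open Scope classical_set_scope.
Local Open Scope ring_scope.

Section Topology.
Context (R : realType).

Definition unit_disk (n : nat) : set 'rV[R]_n :=
  [set x | \sum_(i < n) x ord0 i ^+ 2 <= 1].

(* The sphere of dimension n - 1 in R^n; it is empty for n = 0. *)
Definition unit_sphere (n : nat) : set 'rV[R]_n :=
  [set x | \sum_(i < n) x ord0 i ^+ 2 = 1].

Definition contractible (X : topologicalType) : Prop :=
  exists (x0 : X) (F : R * X -> X),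
    [/\ {within `[0, 1]%classic `*` [set: X], continuous F},
        forall x, F (0, x) = x & forall x, F (1, x) = x0].

End Topology.

Arguments unit_disk R n : clear implicits.
Arguments unit_sphere R n : clear implicits.

Definition homeomorphic (X Y : topologicalType) : Prop :=
  exists (f : X -> Y) (g : Y -> X),
    [/\ continuous f, continuous g, cancel f g & cancel g f].

(* Continuous left actions of a discrete group: joint continuity of G * X -> X
   is continuity of each translation. *)
Record gaction (G : groupType) (X : topologicalType) := GAction {
  gact :> G -> X -> X;
  gact1 : forall x, gact 1%g x = x;
  gactM : forall g h x, gact (g * h)%g x = gact g (gact h x);
  gact_continuous : forall g, continuous (gact g) }.

Section OrbitSpace.
Context (G : groupType) (X : topologicalType) (a : gaction G X).

Definition same_orbit (x y : X) : bool := `[< exists g, y = a g x >].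

Lemma same_orbit_equiv : equiv_class_of same_orbit.
Proof.
split=> [x|x y|y x z].
- by apply/asboolP; exists 1%g; rewrite gact1.
- by apply/asboolP/asboolP => -[g ->]; exists (g^-1)%g;
    rewrite -gactM mulVg gact1.
- move=> /asboolP[g ->] /asboolP[h ->]; apply/asboolP.
  by exists (h * g)%g; rewrite gactM.
Qed.

Definition orbit_equiv : equiv_rel X := EquivRelPack same_orbit_equiv.

Definition orbit_space : topologicalType :=
  quotient_topology {eq_quot orbit_equiv}%qT.

Definition fixed_set (H : {pred G}) : set X :=
  [set x | forall h, h \in H -> a h x = x].

Definition isotropy (x : X) : set G := [set g | a g x = x].

End OrbitSpace.

Section GCW.
Context (R : realType) (G : groupType).

Definition left_translate (g : G) (c : set G) : set G :=
  [set (g * x)%g | x in c].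

Definition left_cosets (H : {pred G}) : set (set G) :=
  [set left_translate g [set` H] | g in [set: G]].

(* A continuous G-map on the G-invariant subspace A of X. *)
Definition gmap_on (X Z : topologicalType) (a : gaction G X) (b : gaction G Z)
    (A : set X) (f : X -> Z) : Prop :=
  {within A, continuous f} /\ forall g x, A x -> f (a g x) = b g (f x).

(* A continuous G-map to Z from the coproduct over i : I of G/H_i * D^n.
   As G/H_i is discrete, it is a family of continuous maps on D^n indexed by
   the pairs (i, c) with c a left coset of H_i; the values of v at other sets c
   or outside the disk are irrelevant. *)
Definition cell_gmap (n : nat) (I : Type) (H : I -> {pred G})
    (Z : topologicalType) (b : gaction G Z)
    (v : I -> set G -> 'rV[R]_n -> Z) : Prop :=
  forall i c, left_cosets (H i) c ->
    {within unit_disk R n, continuous (v i c)} /\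
    forall g x, unit_disk R n x -> v i (left_translate g c) x = b g (v i c x).

(* B is obtained from A by attaching the equivariant n-cells G/H_i * D^n with
   characteristic maps q i, that is, the square

      coprod_i G/H_i * S^(n-1) --> A
                |                  |
                v                  v
      coprod_i G/H_i * D^n  -- q -> B

   is a pushout of G-spaces, A and B having the subspace topology of X. *)
Definition attaches_gcells (X : topologicalType) (a : gaction G X) (n : nat)
    (A B : set X) (I : Type) (H : I -> {pred G})
    (q : I -> set G -> 'rV[R]_n -> X) : Prop :=
  [/\ A `<=` B,
      cell_gmap H a q,
      (forall i c x, left_cosets (H i) c -> unit_disk R n x -> B (q i c x)),
      (forall i c x, left_cosets (H i) c -> unit_sphere R n x -> A (q i c x)) &
      forall (Z : topologicalType) (b : gaction G Z)
        (u : X -> Z) (v : I -> set G -> 'rV[R]_n -> Z),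
        gmap_on a b A u -> cell_gmap H b v ->
        (forall i c x, left_cosets (H i) c -> unit_sphere R n x ->
           u (q i c x) = v i c x) ->
        let glues w :=
          [/\ gmap_on a b B w,
              (forall x, A x -> w x = u x) &
              forall i c x, left_cosets (H i) c -> unit_disk R n x ->
                w (q i c x) = v i c x] in
        (exists w, glues w) /\
        (forall w w', glues w -> glues w' -> forall x, B x -> w x = w' x)].

(* With the usual numbering of skeleta, sk n is X_(n-1): it starts at
   X_(-1) = set0, and sk n.+1 is sk n with n-cells attached. *)
Definition is_GCW_complex (X : topologicalType) (a : gaction G X) : Prop :=
  exists sk : nat -> set X,
    [/\ sk 0%N = set0,
        (forall n g x, sk n x -> sk n (a g x)),
        (forall n, exists (I : Type) (H : I -> {pred G})
           (q : I -> set G -> 'rV[R]_n -> X),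
           (forall i, group_closed (H i)) /\
           attaches_gcells a (sk n) (sk n.+1) H q),
        \bigcup_n sk n = [set: X] &
        forall C : set X,
          (forall n, closed (C : set (subspace (sk n)))) -> closed C].

Definition is_model_for_EG (X : topologicalType) (a : gaction G X) : Prop :=
  [/\ is_GCW_complex a,
      (forall x, finite_set (isotropy a x)) &
      forall H : {pred G}, group_closed H -> finite_set [set` H] ->
        contractible R (set_type (fixed_set a H))].

End GCW.

Definition heis (A : Type) : Type := (A * A * A)%type.

HB.instance Definition _ (A : choiceType) := Choice.on (heis A).
HB.instance Definition _ (R : realType) := Topological.on (heis R).

Section Heisenberg.
Context (A : comNzRingType).
Implicit Types g h : heis A.

Definition heis_mul g h : heis A :=
  let: (a, b, c) := g in let: (x, y, z) := h in
  (a + x, b + y + a * z, c + z).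

Definition heis_one : heis A := (0, 0, 0).

Definition heis_inv g : heis A :=
  let: (x, y, z) := g in (- x, x * z - y, - z).

Lemma heis_mulA : associative heis_mul.
Proof.
by move=> [[a b] c] [[x y] z] [[k l] m]; rewrite /heis_mul; congr (_, _, _); ring.
Qed.

Lemma heis_mul1g : left_id heis_one heis_mul.
Proof. by move=> [[x y] z]; rewrite /heis_mul /=; congr (_, _, _); ring. Qed.

Lemma heis_mulg1 : right_id heis_one heis_mul.
Proof. by move=> [[x y] z]; rewrite /heis_mul /=; congr (_, _, _); ring. Qed.

Lemma heis_mulVg : left_inverse heis_one heis_inv heis_mul.
Proof. by move=> [[x y] z]; rewrite /heis_mul /=; congr (_, _, _); ring. Qed.

Lemma heis_mulgV : right_inverse heis_one heis_inv heis_mul.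
Proof. by move=> [[x y] z]; rewrite /heis_mul /=; congr (_, _, _); ring. Qed.

HB.instance Definition _ := isGroup.Build (heis A)
  heis_mulA heis_mul1g heis_mulg1 heis_mulVg heis_mulgV.

Definition heis_mx g : 'M[A]_3 :=
  let: (x, y, z) := g in
  \matrix_(i, j) nth 0 (nth [::] [:: [:: 1; x; y]; [:: 0; 1; z]; [:: 0; 0; 1]] i) j.

Lemma heis_mx_inj : injective heis_mx.
Proof.
move=> [[a b] c] [[x y] z] /matrixP E.
have := E ord0 (inord 1); have := E ord0 (inord 2); have := E (inord 1) (inord 2).
by rewrite !mxE !inordK //= => -> -> ->.
Qed.

Lemma heis_mxM g h : heis_mx (g * h)%g = heis_mx g *m heis_mx h.
Proof.
case: g h => [[a b] c] [[x y] z]; apply/matrixP => i j.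
rewrite !mxE !big_ord_recl big_ord0 !mxE /=.
by case: i => [[|[|[|//]]] ?]; case: j => [[|[|[|//]]] ?] /=; ring.
Qed.

Definition heis_rot g : heis A := let: (x, y, z) := g in (- z, y - x * z, x).

Lemma heis_rotM g h : heis_rot (g * h)%g = (heis_rot g * heis_rot h)%g.
Proof.
case: g h => [[a b] c] [[x y] z].
by rewrite /heis_rot /mul /= /heis_mul; congr (_, _, _); ring.
Qed.

Lemma heis_rot4 g : iter 4 heis_rot g = g.
Proof. by case: g => [[x y] z] /=; congr (_, _, _); ring. Qed.

Lemma iter_heis_rotM n g h :
  iter n heis_rot (g * h)%g = (iter n heis_rot g * iter n heis_rot h)%g.
Proof. by elim: n => //= n ->; rewrite heis_rotM. Qed.

Lemma iter_heis_rotD (i j : 'Z_4) g :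
  iter (i + j)%R heis_rot g = iter i heis_rot (iter j heis_rot g).
Proof.
rewrite -iterD [in RHS](divn_eq (i + j) 4) addnC iterD /=.
by elim: ((i + j) %/ 4)%N => [|n IHn]; rewrite ?mulSn ?iterD ?heis_rot4.
Qed.

Lemma iter_heis_rot1 n : iter n heis_rot 1%g = 1%g.
Proof.
by elim: n => //= n ->; rewrite /heis_rot /one /= /heis_one; congr (_, _, _); ring.
Qed.

End Heisenberg.

(* The elements of Hei(A) with integer entries form the image of heis int
   (bijectively so for A of characteristic 0). *)
Definition heis_intr (A : comNzRingType) (g : heis int) : heis A :=
  let: (x, y, z) := g in (x%:~R, y%:~R, z%:~R).

Lemma heis_intrM (A : comNzRingType) (g h : heis int) :
  heis_intr A (g * h)%g = (heis_intr A g * heis_intr A h)%g.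
Proof.
case: g h => [[a b] c] [[x y] z].
by rewrite /mul /= /heis_mul; congr (_, _, _); rewrite !intrD ?intrM.
Qed.

Lemma heis_intr_iter_rot (A : comNzRingType) n (g : heis int) :
  heis_intr A (iter n (@heis_rot int) g) = iter n (@heis_rot A) (heis_intr A g).
Proof.
elim: n => //= n <-; case: (iter n _ g) => [[x y] z] /=.
by congr (_, _, _); rewrite ?intrN ?intrD ?intrN ?intrM.
Qed.

(* The semi-direct product of heis int with Z/4, whose elements (h, i) stand
   for h t^i, where t h t^-1 = heis_rot h. *)
Definition heis_Z4 : Type := (heis int * 'Z_4)%type.

HB.instance Definition _ := Choice.on heis_Z4.

Section SemiDirect.
Implicit Types g h : heis_Z4.

Definition heis_Z4_mul g h : heis_Z4 :=
  ((g.1 * iter g.2 (@heis_rot int) h.1)%g, g.2 + h.2).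

Definition heis_Z4_one : heis_Z4 := (1%g, 0).

Definition heis_Z4_inv g : heis_Z4 :=
  (iter (- g.2)%R (@heis_rot int) (g.1^-1)%g, - g.2).

Lemma heis_Z4_mulA : associative heis_Z4_mul.
Proof.
move=> g h k; congr (_, _); last exact: addrA.
by rewrite [in RHS]iter_heis_rotD -mulgA -iter_heis_rotM.
Qed.

Lemma heis_Z4_mul1g : left_id heis_Z4_one heis_Z4_mul.
Proof. by move=> [g i]; rewrite /heis_Z4_mul /= mul1g add0r. Qed.

Lemma heis_Z4_mulg1 : right_id heis_Z4_one heis_Z4_mul.
Proof. by move=> [g i]; rewrite /heis_Z4_mul /= iter_heis_rot1 mulg1 addr0. Qed.

Lemma heis_Z4_mulVg : left_inverse heis_Z4_one heis_Z4_inv heis_Z4_mul.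
Proof.
move=> [g i]; rewrite /heis_Z4_mul /heis_Z4_inv /=.
by rewrite -iter_heis_rotM mulVg iter_heis_rot1 addNr.
Qed.

Lemma heis_Z4_mulgV : right_inverse heis_Z4_one heis_Z4_inv heis_Z4_mul.
Proof.
move=> g; congr (_, _); last exact: addrN.
by rewrite -[X in (_ * X)%g]iter_heis_rotD addrN mulgV.
Qed.

HB.instance Definition _ := isGroup.Build heis_Z4
  heis_Z4_mulA heis_Z4_mul1g heis_Z4_mulg1 heis_Z4_mulVg heis_Z4_mulgV.

End SemiDirect.

Section HeisenbergAction.
Context (R : realType).

Definition heis_act (g : heis_Z4) (x : heis R) : heis R :=
  (heis_intr R g.1 * iter g.2 (@heis_rot R) x)%g.

Lemma heis_act1 x : heis_act 1%g x = x.
Proof.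
by rewrite /heis_act (_ : heis_intr R _ = 1%g) ?mul1g.
Qed.

Lemma heis_actM g h x : heis_act (g * h)%g x = heis_act g (heis_act h x).
Proof.
rewrite /heis_act heis_intrM heis_intr_iter_rot.
by rewrite [in LHS]iter_heis_rotD iter_heis_rotM mulgA.
Qed.

Lemma heis_continuous (f : heis R -> heis R) :
  continuous (fun x => (f x).1.1) -> continuous (fun x => (f x).1.2) ->
  continuous (fun x => (f x).2) -> continuous f.
Proof.
move=> f1 f2 f3 x.
have -> : f = fun x => ((f x).1.1, (f x).1.2, (f x).2).
  by apply/funext => y; case: (f y) => [[]].
exact: (cvg_pair (cvg_pair (f1 x) (f2 x)) (f3 x)).
Qed.

Lemma heis_coord1_continuous : continuous (fun x : heis R => x.1.1).
Proof. by move=> x; apply: cvg_comp; [exact: cvg_fst|exact: cvg_fst]. Qed.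

Lemma heis_coord2_continuous : continuous (fun x : heis R => x.1.2).
Proof. by move=> x; apply: cvg_comp; [exact: cvg_fst|exact: cvg_snd]. Qed.

Lemma heis_coord3_continuous : continuous (fun x : heis R => x.2).
Proof. by move=> x; exact: cvg_snd. Qed.

Lemma heis_rot_continuous : continuous (@heis_rot R : heis R -> heis R).
Proof.
have c1 := heis_coord1_continuous.
have c2 := heis_coord2_continuous.
have c3 := heis_coord3_continuous.
apply: heis_continuous.
- rewrite (_ : (fun x => _) = fun x : heis R => - x.2).
    by move=> x; apply: cvgN; exact: c3.
  by apply/funext => -[[]].
- rewrite (_ : (fun x => _) = fun x : heis R => x.1.2 - x.1.1 * x.2).
    by move=> x; apply: cvgB; [exact: c2|apply: cvgM; [exact: c1|exact: c3]].
  by apply/funext => -[[]].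
- rewrite (_ : (fun x => _) = fun x : heis R => x.1.1); first exact: c1.
  by apply/funext => -[[]].
Qed.

Lemma heis_mul_continuous (g : heis R) :
  continuous (fun x : heis R => (g * x)%g : heis R).
Proof.
have c1 := heis_coord1_continuous.
have c2 := heis_coord2_continuous.
have c3 := heis_coord3_continuous.
case: g => [[a b] c]; apply: heis_continuous.
- rewrite (_ : (fun x => _) = fun x : heis R => a + x.1.1).
    by move=> x; apply: cvgD; [exact: cvg_cst|exact: c1].
  by apply/funext => -[[]].
- rewrite (_ : (fun x => _) = fun x : heis R => b + x.1.2 + a * x.2).
    move=> x; apply: cvgD; first by apply: cvgD; [exact: cvg_cst|exact: c2].
    by apply: cvgM; [exact: cvg_cst|exact: c3].
  by apply/funext => -[[]].
- rewrite (_ : (fun x => _) = fun x : heis R => c + x.2).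
    by move=> x; apply: cvgD; [exact: cvg_cst|exact: c3].
  by apply/funext => -[[]].
Qed.

Lemma heis_act_continuous g : continuous (heis_act g).
Proof.
have it n : continuous (iter n (@heis_rot R) : heis R -> heis R).
  elim: n => [|n IHn] x; first exact: cvg_id.
  by apply: continuous_comp; [exact: IHn|exact: heis_rot_continuous].
by move=> x; apply: continuous_comp; [exact: it|exact: heis_mul_continuous].
Qed.

Definition heis_action : gaction heis_Z4 (heis R) :=
  GAction heis_act1 heis_actM heis_act_continuous.

End HeisenbergAction.

(* Main.v *)
Require Import Defs.
From mathcomp Require Import all_boot all_order all_algebra.
From mathcomp Require Import generic_quotient ring lra zify.
From mathcomp Require Import all_classical all_reals all_analysis.

(** In the coordinates (x, y - xz/2, z) of Hei(R) the group G acts by affine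
   maps. Hence the fixed set of a finite subgroup is an affine subspace, nonempty
   because it contains the mean of any orbit, and so contractible.

   The square [0,1/2]^2 is a fundamental domain for the action of Z^2 x| Z/4 on
   the (x, z)-plane. We parametrize the part of Hei(R) over it by triples
   (t, s, v), where t = x + z, s in [-1,1] is an affine coordinate on the segment
   x + z = t of the square, and v is y - xz/2 corrected by a multiple of s in such
   a way that the elements of G gluing the sides of the square map (t, -1, v) to
   (t, 1, v). The segment degenerates at the corners t = 0 and t = 1; the
   stabilizer of the fibre over the latter is infinite cyclic and translates the
   fibre by 1/4, which is 2 in the coordinate s.
   - The faces of the cube [0,1] x [-1,1] x [0,1], subdivided at the points with
     isotropy group Z/2 (t = 1/2, s = 1), are the equivariant cells.
   - The map (t, s, v) |-> (sqrt (1 - t) e^(2 pi i v), sqrt t e^(2 pi i (4v + s/2)))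
     from the cube onto S^3 in C^2 identifies two points exactly when they are in
     the same G-orbit. It exhibits the orbit space as the Seifert fibration of S^3
     with one exceptional fibre, of multiplicity 4. *)

Set Implicit Arguments.
Unset Strict Implicit.
Unset Printing Implicit Defensive.

Import Order.TTheory GRing.Theory Num.Theory.
Import numFieldNormedType.Exports.

Local Open Scope classical_set_scope.
Local Open Scope ring_scope.

(** * Gluing continuous maps along locally finite families of compact images *)

Section LocallyFiniteGluing.

(** A point of the closure has a neighbourhood meeting only finitely many [K j], so it lies in the
    closure of their union, which is already closed. *)
Lemma locally_finite_closed (X : topologicalType) (J : choiceType) (D : set J)
    (K : J -> set X) :
  (forall j, D j -> closed (K j)) ->
  (forall p : X, exists2 U, nbhs p U &
     finite_set [set j | D j /\ (U `&` K j) !=set0]) ->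
  closed (\bigcup_(j in D) K j).
Proof.
move=> Kc lf p pK; have [U pU Ufin] := lf p.
set E := [set j | _] in Ufin.
suff: (\bigcup_(j in E) K j) p by move=> [j [Dj _] Kjp]; exists j.
have cE : closed (\bigcup_(j in E) K j).
  by apply: closed_bigcup => // j [/Kc].
apply: cE => V pV; have [q [[j Dj Kjq] [Uq Vq]]] := pK _ (filterI pU pV).
by exists q; split=> //; exists j => //; split=> //; exists q.
Qed.

(** The part of [C] that [w \o k] sends into [F] is closed in a compact set, hence compact; its
    image under [k] is compact, so closed in the Hausdorff space [X]. *)
Lemma compact_image_preimage_closed (T X Z : topologicalType) (C : set T)
    (k : T -> X) (w : X -> Z) (F : set Z) :
  hausdorff_space X -> compact C -> {within C, continuous k} ->
  {within C, continuous (w \o k)} -> closed F ->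
  closed (k @` C `&` w @^-1` F).
Proof.
move=> hX cC kc wkc Fc.
have /closed_subspaceP[V Vc VC] := (continuous_closedP _).1 wkc _ Fc.
have -> : k @` C `&` w @^-1` F = k @` (V `&` C).
  rewrite eqEsubset; split=> [_ [[t Ct <-] /= wF]|_ [t Ct <-]].
    by exists t => //; have : ((w \o k) @^-1` F `&` C) t by []; rewrite -VC.
  by have : (V `&` C) t by []; rewrite VC => -[wF Ct']; split=> //; exists t.
apply: compact_closed => //; apply: continuous_compact.
  exact: continuous_subspaceW kc.
by rewrite setIC; exact: compact_closedI.
Qed.

(** Continuity of [w] can be tested on the parameter spaces, because the preimage of a closed set is
    a locally finite union of closed pieces. The spaces [T' j] vary with [j] so that disks of
    different dimensions can be glued together. *)
Lemma glue_continuous (X Z : topologicalType) (J : choiceType)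
    (D : set J) (T' : J -> topologicalType) (C : forall j, set (T' j))
    (k : forall j, T' j -> X) (w : X -> Z) :
  hausdorff_space X ->
  (forall j, D j -> compact (C j)) ->
  (forall j, D j -> {within C j, continuous (k j)}) ->
  (forall p : X, exists2 U, nbhs p U &
     finite_set [set j | D j /\ (U `&` k j @` C j) !=set0]) ->
  (forall j, D j -> {within C j, continuous (w \o k j)}) ->
  {within \bigcup_(j in D) k j @` C j, continuous w}.
Proof.
move=> hX Cc kc lf wkc; apply/continuous_closedP => F Fc.
apply/closed_subspaceP.
exists (\bigcup_(j in D) (k j @` C j `&` w @^-1` F)).
  apply: locally_finite_closed => [j Dj|p].
    exact: compact_image_preimage_closed (Cc j Dj) (kc j Dj) (wkc j Dj) Fc.
  have [U pU Ufin] := lf p; exists U => //; apply: sub_finite_set Ufin.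
  by move=> j [Dj [q [Uq [kq _]]]]; split=> //; exists q.
rewrite eqEsubset; split=> [p [[j Dj [kp wp]] Dp]|p [wp [j Dj kp]]]; split=> //.
  by exists j.
by exists j.
Qed.

End LocallyFiniteGluing.

(** * The radial homeomorphism from the disk to the cube *)

Section RadialMap.
Context (R : realType).
Implicit Types n : nat.

Definition norm2 n (x : 'rV[R]_n) : R := Num.sqrt (\sum_(i < n) x ord0 i ^+ 2).

(** At [x = 0] the quotient is 0 / 0 = 0. *)
Definition disk_to_cube n (x : 'rV[R]_n) : 'rV[R]_n := (norm2 x / `|x|) *: x.

Lemma sum_sqr_ge0 n (x : 'rV[R]_n) : 0 <= \sum_(i < n) x ord0 i ^+ 2.
Proof. by apply: sumr_ge0 => i _; exact: sqr_ge0. Qed.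

Lemma norm2_ge0 n (x : 'rV[R]_n) : 0 <= norm2 x.
Proof. exact: sqrtr_ge0. Qed.

Lemma norm2Z n (a : R) (x : 'rV[R]_n) : norm2 (a *: x) = `|a| * norm2 x.
Proof.
rewrite /norm2 -sqrtr_sqr -sqrtrM ?sqr_ge0//; congr Num.sqrt.
by rewrite mulr_sumr; apply: eq_bigr => i _; rewrite !mxE exprMn.
Qed.

Lemma norm2_eq0 n (x : 'rV[R]_n) : (norm2 x == 0) = (x == 0).
Proof.
apply/idP/eqP => [|->]; last first.
  by rewrite /norm2 big1 ?sqrtr0// => i _; rewrite mxE expr0n.
rewrite sqrtr_eq0 => x0; apply/rowP => i; rewrite mxE.
have : \sum_(i < n) x ord0 i ^+ 2 == 0 by rewrite eq_le x0 sum_sqr_ge0.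
rewrite psumr_eq0; last by move=> j _; exact: sqr_ge0.
by move=> /allP/(_ i (mem_index_enum _)); rewrite sqrf_eq0 => /eqP.
Qed.

Lemma unit_diskE n (x : 'rV[R]_n) : unit_disk R n x <-> norm2 x <= 1.
Proof.
by rewrite /unit_disk /norm2 /= -{2}(sqrtr1 R) ler_psqrt// nnegrE// sum_sqr_ge0.
Qed.

Lemma unit_sphereE n (x : 'rV[R]_n) : unit_sphere R n x <-> norm2 x = 1.
Proof.
rewrite /unit_sphere /norm2 /= -{2}(sqrtr1 R); split=> [->//|/eqP].
by rewrite eqr_sqrt// ?sum_sqr_ge0// => /eqP.
Qed.

(** The norm on the left is the sup norm, so the Euclidean disk and sphere correspond to the cube
    and its boundary. *)
Lemma norm_disk_to_cube n (x : 'rV[R]_n) : `|disk_to_cube x| = norm2 x.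
Proof.
rewrite /disk_to_cube normrZ normrM normfV normr_id (ger0_norm (norm2_ge0 x)).
have [->|x0] := eqVneq x 0; last by rewrite divfK// normr_eq0.
by rewrite normr0 mulr0; apply/esym/eqP; rewrite norm2_eq0.
Qed.

Lemma disk_to_cube_inj n : injective (@disk_to_cube n).
Proof.
move=> x y xy; have nxy : norm2 x = norm2 y by rewrite -!norm_disk_to_cube xy.
have [x0|x0] := eqVneq x 0.
  by apply/eqP; rewrite x0 eq_sym -norm2_eq0 -nxy x0 norm2_eq0.
have r0 : norm2 x != 0 by rewrite norm2_eq0.
have y0 : y != 0 by rewrite -norm2_eq0 -nxy.
have E : x = (`|x| / `|y|) *: y.
  move: xy => /(congr1 (fun z => (`|x| / norm2 x) *: z)).
  rewrite /disk_to_cube !scalerA -nxy !mulrA !divfK// divff ?normr_eq0//.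
  by rewrite scale1r.
move: nxy; rewrite E norm2Z => /eqP; rewrite -subr_eq0 -{2}(mul1r (norm2 y)).
rewrite -mulrBl mulf_eq0 norm2_eq0 (negbTE y0) orbF subr_eq0 => /eqP.
by rewrite ger0_norm ?divr_ge0// => ->; rewrite scale1r.
Qed.

Lemma disk_to_cube_surj n (y : 'rV[R]_n) : exists x, disk_to_cube x = y.
Proof.
have [->|y0] := eqVneq y 0.
  by exists 0; apply/eqP; rewrite -normr_eq0 norm_disk_to_cube norm2_eq0.
have ny0 : `|y| != 0 by rewrite normr_eq0.
have r0 : norm2 y != 0 by rewrite norm2_eq0.
have a0 : 0 < `|y| / norm2 y by rewrite divr_gt0 ?normr_gt0// lt_neqAle eq_sym r0 norm2_ge0.
exists ((`|y| / norm2 y) *: y).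
rewrite /disk_to_cube norm2Z (gtr0_norm a0) normrZ (gtr0_norm a0) scalerA -[RHS]scale1r.
by congr (_ *: _); field; rewrite ny0 r0.
Qed.

Lemma norm2_continuous n : continuous (@norm2 n).
Proof.
have c : continuous (fun y : 'rV[R]_n => \sum_(i < n) y ord0 i ^+ 2).
  apply: continuous_big => [z|i _ y]; first exact: (@add_continuous R^o z).
  exact: (continuous_comp (@coord_continuous _ _ _ _ _ y) (@exprn_continuous _ _ _)).
by move=> x; apply: continuous_comp; [exact: c|exact: sqrt_continuous].
Qed.

Lemma disk_to_cube_continuous n : continuous (@disk_to_cube n).
Proof.
move=> x; have [->|x0] := eqVneq x 0.
  (* The scalar factor need not be continuous at 0; there the sup norm of the image is [norm2],
     which tends to 0. *)
  have k0 : disk_to_cube 0 = 0 :> 'rV[R]_n by rewrite /disk_to_cube scaler0.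
  rewrite /continuous_at k0.
  have := @norm2_continuous n 0; rewrite /continuous_at.
  have /eqP -> : norm2 (0 : 'rV[R]_n) == 0 by rewrite norm2_eq0.
  have -> : @norm2 n = (fun y => `|disk_to_cube y|).
    by apply/funext => y; rewrite norm_disk_to_cube.
  by move=> h; apply: (@norm_cvg0 _ _ _ (nbhs (0 : 'rV[R]_n))).
apply: (@cvgZ _ _ _ (nbhs (x : 'rV[R]_n))); last exact: cvg_id.
apply: (@cvgM _ _ (nbhs (x : 'rV[R]_n))); first exact: norm2_continuous.
by apply: (@cvgV _ _ (nbhs (x : 'rV[R]_n))); [rewrite normr_eq0|exact: norm_continuous].
Qed.

Lemma unit_disk_compact n : compact (unit_disk R n).
Proof.
have -> : unit_disk R n = (@norm2 n) @^-1` [set r | r <= 1].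
  by apply/seteqP; split=> x /unit_diskE.
apply: (@subclosed_compact _ _ [set v : 'rV[R]_n | forall i, `[-1, 1]%classic (v ord0 i)]).
- exact: ((continuous_closedP _).1 (@norm2_continuous n) _ (@closed_le R 1)).
- exact: (@rV_compact R n (fun=> `[-1, 1]%classic) (fun=> @segment_compact R (-1) 1)).
- move=> x /= x1 i; rewrite in_itv /= -ler_norml.
  rewrite -sqrtr_sqr; apply: le_trans x1; rewrite ler_wsqrtr//.
  by rewrite (bigD1 i)//= lerDl sumr_ge0// => j _; exact: sqr_ge0.
Qed.

Lemma coord_le_norm n (x : 'rV[R]_n) i : `|x ord0 i| <= `|x|.
Proof. by rewrite /Num.norm /= mx_normrE; apply: (le_bigmax _ _ (ord0, i)). Qed.

Lemma norm_attained n (x : 'rV[R]_n) : x != 0 -> exists i, `|x ord0 i| = `|x|.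
Proof.
rewrite -normr_eq0 => x0; have [[i j] /= E] := mx_norm_neq0 x0.
by exists j; rewrite (ord1 i) in E; rewrite -E.
Qed.

End RadialMap.

(** * Equivariant CW structures from families of cells *)

Lemma within_comp (X Y Z : topologicalType) (A : set X) (f : X -> Y) (g : Y -> Z) :
  {within A, continuous f} -> continuous g -> {within A, continuous (g \o f)}.
Proof.
by move=> cf cg x; exact: (@continuous_comp (subspace A) _ _ f g x (cf x) (cg (f x))).
Qed.

Lemma within_comp_in (X Y Z : topologicalType) (A : set X) (B : set Y)
    (f : X -> Y) (g : Y -> Z) :
  {within A, continuous f} -> {within B, continuous g} ->
  (forall x, A x -> B (f x)) -> {within A, continuous (g \o f)}.
Proof.
move=> /subspace_continuousP cf /subspace_continuousP cg AB.
apply/subspace_continuousP => x Ax V /(cg _ (AB x Ax)) BV.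
have := cf x Ax _ BV; apply: (@filterS _ (nbhs x)) => y /= BVy Ay.
by apply: BVy => //; exact: AB.
Qed.

Section CellStructure.
Context (R : realType) (G : groupType) (X : topologicalType) (a : gaction G X).
Context (I : nat -> finType) (q : forall n, I n -> 'rV[R]_n -> X).
Arguments q {n}.
Hypothesis X_hausdorff : hausdorff_space X.
Hypothesis q_continuous : forall n (i : I n), {within unit_disk R n, continuous (q i)}.
(** The third conclusion is the rigidity required of equivariant cells: an element under which an
    open cell meets itself acts trivially on the closed cell, so a single subgroup describes the
    whole cell. *)
Hypothesis q_inj : forall n (i j : I n) g x y,
  norm2 x < 1 -> norm2 y < 1 -> a g (q i x) = q j y ->
  [/\ i = j, x = y & forall z, norm2 z <= 1 -> a g (q i z) = q i z].
Hypothesis q_disjoint : forall m n (i : I m) (j : I n) g x y, (m < n)%N ->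
  norm2 x < 1 -> norm2 y < 1 -> a g (q i x) <> q j y.
Hypothesis q_boundary : forall n (i : I n) x, norm2 x = 1 ->
  exists m (j : I m) g y, [/\ (m < n)%N, norm2 y <= 1 & q i x = a g (q j y)].
Hypothesis q_cover : forall p, exists n (i : I n) g x,
  norm2 x <= 1 /\ p = a g (q i x).
Hypothesis q_dimension : exists N, forall n, (N <= n)%N -> I n -> False.
Hypothesis q_locally_finite : forall p : X, exists2 U, nbhs p U &
  forall n (i : I n),
    finite_set [set g | (U `&` (a g \o q i) @` unit_disk R n) !=set0].

Let actKV g x : a g^-1%g (a g x) = x.
Proof. by rewrite -gactM mulVg gact1. Qed.

Definition skeleton n : set X := [set p | exists m (i : I m) g x,
  [/\ (m < n)%N, norm2 x <= 1 & p = a g (q i x)]].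

Lemma skeleton_act n g p : skeleton n p -> skeleton n (a g p).
Proof.
by move=> [m [i [h [x [mn x1 ->]]]]]; exists m, i, (g * h)%g, x; rewrite gactM.
Qed.

Lemma skeleton_actE n g p : skeleton n (a g p) -> skeleton n p.
Proof. by move=> /(skeleton_act g^-1%g); rewrite actKV. Qed.

(** A boundary point lies in a translate of a cell of smaller dimension, so induction on the
    dimension ends in an open cell. *)
Lemma mem_open_cell n (i : I n) x : norm2 x <= 1 ->
  exists m (j : I m) g y, [/\ (m <= n)%N, norm2 y < 1 & q i x = a g (q j y)].
Proof.
elim/ltn_ind: n i x => n IH i x; rewrite le_eqVlt => /orP[/eqP x1|x1].
  have [m [j [g [y [mn y1 ->]]]]] := q_boundary i x1.
  have [k [l [h [z [km z1 ->]]]]] := IH m mn j y y1.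
  exists k, l, (g * h)%g, z; split=> //; last by rewrite gactM.
  exact: leq_trans (ltnW mn).
by exists n, i, 1%g, x; rewrite gact1.
Qed.

Lemma open_cell_notin_skeleton n (i : I n) x : norm2 x < 1 -> ~ skeleton n (q i x).
Proof.
move=> x1 [m [j [g [y [mn y1 qE]]]]].
have [k [l [h [z [km z1 E]]]]] := mem_open_cell j y1.
apply: (@q_disjoint k n l i (g * h)%g z x (leq_ltn_trans km mn) z1 x1).
by rewrite gactM -E.
Qed.

(** The translates of the closed cells form a locally finite family of compact images, to which
    [glue_continuous] applies. *)
Lemma skeleton_continuous (Z : topologicalType) n (w : X -> Z) :
  (forall m (i : I m) g, (m < n)%N ->
     {within unit_disk R m, continuous (w \o (a g \o q i))}) ->
  {within skeleton n, continuous w}.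
Proof.
move=> wc; pose J := ({m : 'I_n & I m} * G)%type.
pose k (j : J) : 'rV[R]_(tag j.1) -> X := a j.2 \o q (tagged j.1).
have -> : skeleton n = \bigcup_(j in [set: J]) k j @` unit_disk R (tag j.1).
  apply/seteqP; split=> p.
    move=> [m [i [g [x [mn /unit_diskE x1 ->]]]]].
    by exists (Tagged (fun m : 'I_n => I m) (i : I (Ordinal mn)), g) => //; exists x.
  move=> [[[m i] g] _ [x /unit_diskE x1 <-]].
  by exists m, i, g, x; split.
apply: glue_continuous => //.
- by move=> j _; exact: unit_disk_compact.
- by move=> j _; apply: within_comp; [exact: q_continuous|exact: gact_continuous].
- move=> p; have [U pU fin] := q_locally_finite p; exists U => //.
  apply: (@sub_finite_set _ _ (\bigcup_(t in [set: {m : 'I_n & I m}])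
    [set (t, g) | g in [set g | (U `&` (a g \o q (tagged t)) @` unit_disk R (tag t)) !=set0]])).
    by move=> [t g] [_ Utg]; exists t => //; exists g.
  apply: bigcup_finite => [|t _]; first exact: finite_finset.
  exact/finite_image/fin.
- by move=> [[m i] g] _; exact: wc.
Qed.

(** By [q_inj] this is the isotropy group of every point of the open cell, and it
   fixes the closed cell pointwise. *)
Definition cell_stab n (i : I n) : {pred G} := [pred g | `[< a g (q i 0) = q i 0 >]].

Lemma norm20 n : norm2 (0 : 'rV[R]_n) = 0.
Proof. by apply/eqP; rewrite norm2_eq0. Qed.

Lemma cell_stabP n (i : I n) g x :
  g \in cell_stab i -> norm2 x <= 1 -> a g (q i x) = q i x.
Proof.
move=> /asboolP gq.
by have [|| _ _] := q_inj _ _ gq; [rewrite norm20|rewrite norm20|exact].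
Qed.

Lemma cell_stab_eq n (i : I n) g h x :
  norm2 x < 1 -> a g (q i x) = a h (q i x) -> (h^-1 * g)%g \in cell_stab i.
Proof.
move=> x1 E; have := @q_inj n i i (h^-1 * g)%g x x x1 x1.
rewrite gactM E actKV => /(_ erefl)[_ _ fixd].
by apply/asboolP; apply: fixd; rewrite norm20.
Qed.

Lemma cell_stab_closed n (i : I n) : group_closed (cell_stab i).
Proof.
split=> [|g h]; first by apply/asboolP; rewrite gact1.
move=> /asboolP gq /asboolP hq; apply/asboolP.
by rewrite gactM -{1}hq actKV.
Qed.

(** [xget] chooses a representative of the coset, with 1 as default on the empty set. On the closed
    disk the choice does not matter, as the stabilizer fixes the closed cell pointwise. *)
Definition coset_cell n (i : I n) (c : set G) (x : 'rV[R]_n) : X :=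
  a (xget 1%g c) (q i x).

Lemma coset_cellE n (i : I n) g x : norm2 x <= 1 ->
  coset_cell i (left_translate g [set` cell_stab i]) x = a g (q i x).
Proof.
move=> x1; rewrite /coset_cell; set c := left_translate _ _.
have : c (xget 1%g c).
  apply: (@xgetPex _ 1%g c); exists g; exists 1%g; last by rewrite mulg1.
  by apply/asboolP; rewrite gact1.
by move=> [h hs <-]; rewrite gactM cell_stabP.
Qed.

Lemma left_translateM g h (c : set G) :
  left_translate g (left_translate h c) = left_translate (g * h)%g c.
Proof.
apply/seteqP; split=> [_ [_ [x cx <-] <-]|_ [x cx <-]].
  by exists x => //; rewrite mulgA.
by exists (h * x)%g; [exists x|rewrite mulgA].
Qed.

Lemma left_translate_stab n (i : I n) g h :
  (h^-1 * g)%g \in cell_stab i ->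
  left_translate g [set` cell_stab i] = left_translate h [set` cell_stab i].
Proof.
have sub g' h' : (h'^-1 * g')%g \in cell_stab i ->
    left_translate g' [set` cell_stab i] `<=` left_translate h' [set` cell_stab i].
  move=> s _ [x xs <-]; exists (h'^-1 * g' * x)%g; last by rewrite -mulgA mulVKg.
  move: s xs => /asboolP s /asboolP xs; apply/asboolP.
  by rewrite gactM xs.
move=> s; apply/seteqP; split; apply: sub => //.
move: s => /asboolP s; apply/asboolP.
by rewrite -{1}s -gactM mulgA mulgK mulVg gact1.
Qed.

Lemma left_cosets_translate n (i : I n) g c :
  left_cosets (cell_stab i) c -> left_cosets (cell_stab i) (left_translate g c).
Proof. by move=> [h _ <-]; exists (g * h)%g => //; rewrite left_translateM. Qed.

Lemma coset_cell_gmap n : cell_gmap (@cell_stab n) a (@coset_cell n).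
Proof.
move=> i _ [h _ <-]; split.
  by apply: within_comp; [exact: q_continuous|exact: gact_continuous].
by move=> g x /unit_diskE x1; rewrite left_translateM !coset_cellE// gactM.
Qed.

(** * The pushout property of attaching the [n]-cells *)

Section Attach.
Context (n : nat) (Z : topologicalType) (b : gaction G Z).
Context (u : X -> Z) (v : I n -> set G -> 'rV[R]_n -> Z).
Hypothesis u_gmap : gmap_on a b (skeleton n) u.
Hypothesis v_gmap : cell_gmap (@cell_stab n) b v.
Hypothesis uv : forall i c x, left_cosets (cell_stab i) c -> unit_sphere R n x ->
  u (coset_cell i c x) = v i c x.

(** The graph of the map to be constructed. Only open cells enter the second alternative, which
    makes the two alternatives exclude each other. *)
Let glued p z := (skeleton n p /\ z = u p) \/
  exists i c x, [/\ left_cosets (cell_stab i) c, norm2 x < 1,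
                  p = coset_cell i c x & z = v i c x].

(** A point of an open [n]-cell is not in the skeleton, and by [q_inj] it determines its cell, its
    parameter and its coset, hence the value of [v]. *)
Let glued_fun p z z' : glued p z -> glued p z' -> z = z'.
Proof.
have disj (i : I n) c x : left_cosets (cell_stab i) c -> norm2 x < 1 ->
    ~ skeleton n (coset_cell i c x).
  move=> [g _ <-] x1; rewrite coset_cellE ?ltW// => /skeleton_actE.
  exact: open_cell_notin_skeleton x1.
case=> [[pA ->]|[i [c [x [ci x1 pE ->]]]]]; case=> [[pA' ->]|[j [d [y [dj y1 pE' ->]]]]] //.
- by case: (disj _ _ _ dj y1); rewrite -pE'.
- by case: (disj _ _ _ ci x1); rewrite -pE.
case: ci pE => g _ <-; case: dj pE' => h _ <-.
rewrite !coset_cellE ?ltW// => -> /esym E.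
have := @q_inj n i j (h^-1 * g)%g x y x1 y1.
rewrite gactM E actKV => /(_ erefl)[ij xy _]; subst j y.
by congr (v i _ x); apply: left_translate_stab; exact: cell_stab_eq x1 E.
Qed.

Let w p := xget (u p) [set z | glued p z].

Let wE p z : glued p z -> w p = z.
Proof.
move=> pz; apply: (glued_fun _ pz).
by apply: (@xgetPex _ (u p) (glued p)); exists z.
Qed.

Let w_skel p : skeleton n p -> w p = u p.
Proof. by move=> pA; apply: wE; left. Qed.

Let sphere_skel (i : I n) c x : left_cosets (cell_stab i) c -> unit_sphere R n x ->
  skeleton n (coset_cell i c x).
Proof.
move=> [g _ <-] /unit_sphereE x1; rewrite coset_cellE ?x1//.
apply: skeleton_act.
by have [m [j [h [y [mn y1 ->]]]]] := q_boundary i x1; exists m, j, h, y.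
Qed.

Let w_cell (i : I n) c x : left_cosets (cell_stab i) c -> unit_disk R n x ->
  w (coset_cell i c x) = v i c x.
Proof.
move=> ci /unit_diskE; rewrite le_eqVlt => /orP[/eqP x1|x1].
  have xS : unit_sphere R n x by apply/unit_sphereE.
  by rewrite w_skel ?uv//; exact: sphere_skel.
by apply: wE; right; exists i, c, x; split.
Qed.

Let skel_cases p : skeleton n.+1 p -> skeleton n p \/
  exists (i : I n) c x, [/\ left_cosets (cell_stab i) c, unit_disk R n x & p = coset_cell i c x].
Proof.
move=> [m [i [g [x [mn x1 ->]]]]]; move: mn; rewrite ltnS leq_eqVlt => /orP[/eqP mn|mn].
  right; subst m; exists i, (left_translate g [set` cell_stab i]), x.
  by split; [exists g|exact/unit_diskE|rewrite coset_cellE].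
by left; exists m, i, g, x.
Qed.

Lemma skeleton_pushout :
  let glues w :=
    [/\ gmap_on a b (skeleton n.+1) w,
        (forall x, skeleton n x -> w x = u x) &
        forall i c x, left_cosets (cell_stab i) c -> unit_disk R n x ->
          w (coset_cell i c x) = v i c x] in
  (exists w, glues w) /\
  (forall w w', glues w -> glues w' -> forall x, skeleton n.+1 x -> w x = w' x).
Proof.
move=> glues; split; last first.
  move=> w1 w2 [_ w1s w1c] [_ w2s w2c] p /skel_cases[pA|[i [c [x [ci xD ->]]]]].
    by rewrite w1s ?w2s.
  by rewrite w1c ?w2c.
exists w; split=> //; split; last first.
  move=> g p /skel_cases[pA|[i [c [x [ci xD ->]]]]].
    rewrite !w_skel//; last exact: skeleton_act.
    by rewrite u_gmap.2.
  rewrite -(@coset_cell_gmap n i c ci).2// w_cell//; last exact: left_cosets_translate.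
  by rewrite (v_gmap ci).2// w_cell.
(* Only translated closed cells have to be checked: on those of dimension [n] the map is [v], on the
   smaller ones it is [u]. *)
apply: skeleton_continuous => m i g; rewrite ltnS leq_eqVlt => /orP[/eqP mn|mn].
  subst m; set c := left_translate g [set` cell_stab i].
  have ci : left_cosets (cell_stab i) c by exists g.
  apply: (@subspace_eq_continuous _ _ _ (v i c)); last exact: (v_gmap ci).1.
  move=> x /set_mem xD; rewrite -w_cell//= coset_cellE//; exact/unit_diskE.
apply: (@subspace_eq_continuous _ _ _ (u \o (a g \o q i))).
  move=> x /set_mem /unit_diskE x1; rewrite -[RHS]/(w (a g (q i x))) w_skel//.
  by exists m, i, g, x.
have cq : {within unit_disk R m, continuous (a g \o q i)}.
  by apply: within_comp; [exact: q_continuous|exact: gact_continuous].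
have uc := u_gmap.1.
apply: (within_comp_in cq uc) => x /unit_diskE x1.
by exists m, i, g, x.
Qed.

End Attach.

Theorem cells_GCW_complex : is_GCW_complex R a.
Proof.
have [N dimN] := q_dimension; exists skeleton; split.
- by apply/seteqP; split=> // p [m [i [g [x []]]]].
- by move=> n g x; exact: skeleton_act.
- move=> n; exists (I n), (@cell_stab n), (@coset_cell n); split.
    by move=> i; exact: cell_stab_closed.
  split.
  + by move=> p [m [i [g [x [mn x1 ->]]]]]; exists m, i, g, x; split=> //; exact: ltnW.
  + exact: coset_cell_gmap.
  + move=> i _ x [g _ <-] /unit_diskE x1; rewrite coset_cellE//.
    by exists n, i, g, x.
  + move=> i _ x [g _ <-] /unit_sphereE x1; rewrite coset_cellE ?x1//.
    apply: skeleton_act.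
    by have [m [j [h [y [mn y1 ->]]]]] := q_boundary i x1; exists m, j, h, y.
  + by move=> Z b u v ug vg uv; exact: skeleton_pushout.
- apply/seteqP; split=> // p _; have [n [i [g [x [x1 ->]]]]] := q_cover p.
  by exists n.+1 => //; exists n, i, g, x.
(* By finite dimensionality the skeleton with index [N] is all of [X], so being closed in it is
   being closed in [X]. *)
- move=> C /(_ N); have -> : skeleton N = [set: X].
    apply/seteqP; split=> // p _; have [n [i [g [x [x1 ->]]]]] := q_cover p.
    exists n, i, g, x; split=> //; rewrite ltnNge; apply/negP => /dimN.
    exact.
  by move=> /closed_subspaceP[V Vc]; rewrite !setIT => <-.
Qed.

End CellStructure.

(** * The action on the Heisenberg group *)

Section HeisGeometry.
Context (R : realType).
Implicit Types (x y z t : R) (a b c k : int).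
Local Notation act := (@heis_act R).

Lemma intr_small0 k : -1 < k%:~R :> R -> k%:~R < 1 :> R -> k = 0.
Proof.
rewrite (_ : -1 = (-1)%:~R)// (_ : 1 = 1%:~R)// !ltr_int; lia.
Qed.

Lemma intr_small01 k : -1 < k%:~R :> R -> k%:~R < 2 :> R -> k = 0 \/ k = 1.
Proof.
rewrite (_ : -1 = (-1)%:~R)// (_ : 2 = 2%:~R)// !ltr_int; lia.
Qed.

Lemma heis_act_t0 a b c x y z :
  act ((a, b, c), 0) (x, y, z) = (a%:~R + x, b%:~R + y + a%:~R * z, c%:~R + z).
Proof. by []. Qed.

Lemma heis_act_t1 a b c x y z : act ((a, b, c), 1) (x, y, z) =
  (a%:~R - z, b%:~R + (y - x * z) + a%:~R * x, c%:~R + x).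
Proof. by []. Qed.

Lemma heis_act_t2 a b c x y z : act ((a, b, c), 2%:R) (x, y, z) =
  (a%:~R - x, b%:~R + y - a%:~R * z, c%:~R - z).
Proof.
rewrite /heis_act /=.
by rewrite /mul /= /heis_mul; congr (_, _, _); ring.
Qed.

Lemma heis_act_t3 a b c x y z : act ((a, b, c), 3%:R) (x, y, z) =
  (a%:~R + z, b%:~R + (y - x * z) - a%:~R * x, c%:~R - x).
Proof.
rewrite /heis_act /=.
by rewrite /mul /= /heis_mul; congr (_, _, _); ring.
Qed.

Lemma heis_Z4_cases (g : heis_Z4) : exists a b c,
  [\/ g = ((a, b, c), 0), g = ((a, b, c), 1), g = ((a, b, c), 2%:R) |
      g = ((a, b, c), 3%:R)].
Proof.
case: g => [[[a b] c] i]; exists a, b, c.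
case: i => [[|[|[|[|//]]]] ilt];
  [constructor 1|constructor 2|constructor 3|constructor 4]; congr (_, _); exact: val_inj.
Qed.

(** Of the sides of the square identified by G, (0, r) ~ (r, 0) and
   (r, 1/2) ~ (1/2, r), only the second ones are kept. *)
Definition strict_square x z : Prop :=
  [/\ 0 <= x <= 2^-1, 0 <= z <= 2^-1, x = 0 -> z = 0 & z = 2^-1 -> x = 2^-1].

(** For each power of the rotation the inequalities leave few integer translations. Nontrivial
    powers occur only over (0, 0), (1/2, 0) and (1/2, 1/2). Over the last corner they shift [y] by b
    + 1/4, b - 1/2 or b - 1/4, which is never 0, so no point there is fixed. *)
Lemma strict_square_orbit g x y z x' y' z' :
  strict_square x z -> strict_square x' z' -> act g (x, y, z) = (x', y', z') ->
  [/\ x' = x, z' = z,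
      (exists b, y' = y + b%:~R) \/
        [/\ x = 2^-1, z = 2^-1 & exists k, y' = y + k%:~R / 4] &
      y' = y -> (forall t, act g (x, t, z) = (x, t, z)) /\
        (g = 1%g \/ z = 0 /\ (x = 0 \/ x = 2^-1))].
Proof.
move=> [/andP[x0 x1] /andP[z0 z1] xz zx] [/andP[x0' x1'] /andP[z0' z1'] xz' zx'].
have [a [b [c [] ->]]] := heis_Z4_cases g.
- rewrite heis_act_t0 => -[Ex Ey Ez].
  have a0 : a = 0 by apply: intr_small0; lra.
  have c0 : c = 0 by apply: intr_small0; lra.
  subst a c; split; [lra|lra|left; exists b; lra|move=> yy].
  have b0 : b = 0 by apply: intr_small0; lra.
  by subst b; split=> [t|]; [rewrite heis_act_t0; congr (_, _, _); lra|left].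
- rewrite heis_act_t1 => -[Ex Ey Ez].
  have c0 : c = 0 by apply: intr_small0; lra.
  have [a0|a1] : a = 0 \/ a = 1 by apply: intr_small01; lra.
    subst a c; have ? : x' = 0 by lra.
    have ? := xz' ltac:(lra); have ? : x = 0 by lra.
    have ? : z = 0 by lra.
    subst x z x' z'; split=> //; first by left; exists b; lra.
    move=> yy; have b0 : b = 0 by apply: intr_small0; lra.
    subst b; split=> [t|]; last by right; split=> //; left.
    by rewrite heis_act_t1; congr (_, _, _); lra.
  subst a c; have ? : z = 2^-1 by lra.
  have ? := zx ltac:(lra); have ? : x' = 2^-1 by lra.
  have ? : z' = 2^-1 by lra.
  subst x z x' z'; have yE : y' = y + (4 * b + 1)%:~R / 4 by rewrite intrD intrM; lra.
  split=> //; first by right; split=> //; exists (4 * b + 1).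
  move=> yy; have : (4 * b + 1)%:~R = 0 :> R by lra.
  by move=> /eqP; rewrite intr_eq0; lia.
- rewrite heis_act_t2 => -[Ex Ey Ez].
  have [a0|a1] : a = 0 \/ a = 1 by apply: intr_small01; lra.
    subst a; have ? : x = 0 by lra.
    have ? := xz ltac:(lra); have ? : x' = 0 by lra.
    have ? := xz' ltac:(lra).
    subst x z x' z'; have c0 : c = 0 by apply: intr_small0; lra.
    subst c; split=> //; first by left; exists b; lra.
    move=> yy; have b0 : b = 0 by apply: intr_small0; lra.
    subst b; split=> [t|]; last by right; split=> //; left.
    by rewrite heis_act_t2; congr (_, _, _); lra.
  subst a; have ? : x = 2^-1 by lra.
  have ? : x' = 2^-1 by lra.
  have [c0|c1] : c = 0 \/ c = 1 by apply: intr_small01; lra.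
    subst c; have ? : z = 0 by lra.
    have ? : z' = 0 by lra.
    subst x z x' z'; split=> //; first by left; exists b; lra.
    move=> yy; have b0 : b = 0 by apply: intr_small0; lra.
    subst b; split=> [t|]; last by right; split=> //; right.
    by rewrite heis_act_t2; congr (_, _, _); lra.
  subst c; have ? : z = 2^-1 by lra.
  have ? : z' = 2^-1 by lra.
  subst x z x' z'; have yE : y' = y + (4 * b - 2)%:~R / 4.
    by rewrite intrD intrM; lra.
  split=> //; first by right; split=> //; exists (4 * b - 2).
  move=> yy; have : (4 * b - 2)%:~R = 0 :> R by lra.
  by move=> /eqP; rewrite intr_eq0; lia.
- rewrite heis_act_t3 => -[Ex Ey Ez].
  have a0 : a = 0 by apply: intr_small0; lra.
  subst a.
  have [c0|c1] : c = 0 \/ c = 1 by apply: intr_small01; lra.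
    subst c; have ? : x = 0 by lra.
    have ? := xz ltac:(lra); have ? : x' = 0 by lra.
    have ? : z' = 0 by lra.
    subst x z x' z'; split=> //; first by left; exists b; lra.
    move=> yy; have b0 : b = 0 by apply: intr_small0; lra.
    subst b; split=> [t|]; last by right; split=> //; left.
    by rewrite heis_act_t3; congr (_, _, _); lra.
  subst c; have ? : z' = 2^-1 by lra.
  have ? := zx' ltac:(lra); have ? : x = 2^-1 by lra.
  have ? : z = 2^-1 by lra.
  subst x z x' z'; have yE : y' = y + (4 * b - 1)%:~R / 4.
    by rewrite intrD intrM; lra.
  split=> //; first by right; split=> //; exists (4 * b - 1).
  move=> yy; have : (4 * b - 1)%:~R = 0 :> R by lra.
  by move=> /eqP; rewrite intr_eq0; lia.
Qed.

End HeisGeometry.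

(** * The chart of the fundamental domain *)

Section Chart.
Context (R : realType).
Implicit Types (x y z t s v : R) (a b k : int) (p : heis R).
Local Notation act := (@heis_act R).

(** The half-width 2^-1 - |t - 2^-1| of the segment is min(t, 1 - t), and
   t - 2^-1 + |t - 2^-1| is 2 max(t - 1/2, 0). *)
Definition chart_x t s : R := (t + s * (2^-1 - `|t - 2^-1|)) / 2.
Definition chart_z t s : R := (t - s * (2^-1 - `|t - 2^-1|)) / 2.
Definition chart_y t s : R :=
  s * (t - 2^-1 + `|t - 2^-1|) / 8 + chart_x t s * chart_z t s / 2.

Definition chart (c : R * R * R) : heis R :=
  let: (t, s, v) := c in (chart_x t s, v + chart_y t s, chart_z t s).

(** One triple for each orbit: the sides s = -1 and s = 1 are identified and v
   counts modulo 1; at t = 0 the chart does not depend on s, and at t = 1 only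
   v + s/8 modulo 1/4 matters. *)
Definition strict_chart (c : R * R * R) : Prop :=
  let: (t, s, v) := c in
  [/\ 0 <= t <= 1, -1 < s <= 1, 0 <= v < 1, t = 0 -> s = 0 & t = 1 -> v = 0].

Lemma chart_lowE t s : t <= 2^-1 ->
  [/\ chart_x t s = t * (1 + s) / 2, chart_z t s = t * (1 - s) / 2 &
      chart_y t s = t ^+ 2 * (1 - s ^+ 2) / 8].
Proof.
by move=> t1; rewrite /chart_y /chart_x /chart_z ler0_norm; [split; field|lra].
Qed.

Lemma chart_highE t s : 2^-1 <= t ->
  [/\ chart_x t s = (1 - (1 - t) * (1 - s)) / 2,
      chart_z t s = (1 - (1 - t) * (1 + s)) / 2 &
      chart_y t s = s * (t - 2^-1) / 4 +
        (1 - (1 - t) * (1 - s)) * (1 - (1 - t) * (1 + s)) / 8].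
Proof.
by move=> t1; rewrite /chart_y /chart_x /chart_z ger0_norm; [split; field|lra].
Qed.

Lemma chart_xDz t s : chart_x t s + chart_z t s = t.
Proof. by rewrite /chart_x /chart_z; field. Qed.

Lemma chart_1E s :
  [/\ chart_x 1 s = 2^-1, chart_z 1 s = 2^-1 & chart_y 1 s = (s + 1) / 8].
Proof. by have [|-> -> ->] := @chart_highE 1 s; [lra|split; field]. Qed.

Lemma strict_chart_square t s v : strict_chart (t, s, v) ->
  strict_square (chart_x t s) (chart_z t s).
Proof.
move=> [/andP[t0 t1] /andP[s0 s1] _ ts _].
have [t2|/ltW t2] := lerP t 2^-1.
  have [-> -> _] := chart_lowE s t2.
  have p1 : 0 <= t * (1 + s) by apply: mulr_ge0; lra.
  have p2 : 0 <= t * (1 - s) by apply: mulr_ge0; lra.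
  split; [lra|lra| |] => E.
    have /eqP : t * (1 + s) = 0 by lra.
    by rewrite mulf_eq0 => /orP[/eqP|/eqP]; nra.
  have /eqP : t * (1 + s) = 0 by lra.
  by rewrite mulf_eq0 => /orP[/eqP|/eqP]; lra.
have [-> -> _] := chart_highE s t2.
have p1 : 0 <= (1 - t) * (1 + s) by apply: mulr_ge0; lra.
have p2 : 0 <= (1 - t) * (1 - s) by apply: mulr_ge0; lra.
split; [lra|lra| |] => E.
  have /eqP : (1 - t) * (1 + s) = 0 by lra.
  by rewrite mulf_eq0 => /orP[/eqP|/eqP]; lra.
have /eqP : (1 - t) * (1 + s) = 0 by lra.
by rewrite mulf_eq0 => /orP[/eqP|/eqP]; nra.
Qed.

Lemma chart_x_inj t s s' : 0 < t -> t < 1 -> chart_x t s' = chart_x t s -> s' = s.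
Proof.
move=> t0 t1 E; have m0 : 2^-1 - `|t - 2^-1| != 0.
  by rewrite subr_eq0 eq_sym neq_lt ltr_norml; apply/orP; left; lra.
by apply: (mulIf m0); rewrite /chart_x in E; lra.
Qed.

(** Strict points of one orbit share x and z, hence [t] = x + z and, away from the two corners, [s];
    then [v] is determined modulo 1. The last two conclusions serve to show that the stabilizer of a
    point fixes its whole cell. *)
Lemma strict_chart_orbit g t s v t' s' v' :
  strict_chart (t, s, v) -> strict_chart (t', s', v') ->
  act g (chart (t, s, v)) = chart (t', s', v') ->
  [/\ (t', s', v') = (t, s, v),
      forall u, act g (chart (t, s, u)) = chart (t, s, u) &
      [\/ g = 1%g, t = 0 | t = 2^-1 /\ s = 1]].
Proof.
move=> sc sc' gE.
have [xE zE yE fixE] := strict_square_orbit (strict_chart_square sc)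
  (strict_chart_square sc') gE.
have tE : t' = t by rewrite -(chart_xDz t s) -xE -zE chart_xDz.
subst t'; case: sc => [/andP[t0 t1] /andP[s0 s1] /andP[v0 v1] ts tv].
case: sc' => [_ /andP[s0' s1'] /andP[v0' v1'] ts' tv'].
have [vE sE] : v' = v /\ s' = s.
  have [t10|t1n] := eqVneq t 1.
    subst t; rewrite tv// tv'//; split=> //.
    (* At t = 1 the coordinate y is v + (s + 1)/8 with v = 0, so moving y by k/4 moves [s] by 2k; an
       integer shift [b] is the case k = 4b. The range ]-1, 1] of [s] then forces k = 0. *)
    have : exists k, s' = s + (2 * k)%:~R.
      have [_ _ yE1] := chart_1E s; have [_ _ yE1'] := chart_1E s'.
      rewrite tv// tv'// yE1 yE1' in yE.
      by case: yE => [[b yE]|[_ _ [k yE]]]; [exists (4 * b)|exists k];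
        rewrite !intrM; lra.
    move=> [k sE]; have k0 : k = 0 by apply: (@intr_small0 R); rewrite intrM in sE; lra.
    by rewrite sE k0 mulr0 addr0.
  have sE : s' = s.
    have [t00|t0n] := eqVneq t 0; first by rewrite ts// ts'.
    by apply: (chart_x_inj _ _ xE); rewrite lt_neqAle ?t0 ?t1 ?t1n 1?eq_sym ?t0n.
  split=> //; subst s'; case: yE => [[b yE]|[xh zh _]].
    have b0 : b = 0 by apply: (@intr_small0 R); lra.
    by rewrite b0 in yE; lra.
  have := chart_xDz t s; rewrite xh zh => tE; case/eqP: t1n; lra.
subst s' v'; have [fixg g1] := fixE erefl.
split=> // [u|]; first exact: fixg.
case: g1 => [->|[z0 [x0|xh]]]; [by constructor 1|constructor 2|constructor 3].
  by rewrite -(chart_xDz t s) x0 z0 addr0.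
have tE : t = 2^-1 by rewrite -(chart_xDz t s) xh z0 addr0.
split=> //; have [] := @chart_lowE t s _; first by rewrite tE.
by rewrite xh tE => E _ _; lra.
Qed.

End Chart.

(** * The gluing relations of the chart, and the covering of all orbits by it *)

Section Orbits.
Context (R : realType).
Implicit Types (x y z t s v : R) (a b k : int) (p q : heis R).
Local Notation act := (@heis_act R).

Definition heis_orb p q := exists g, p = act g q.

Lemma heis_orb_refl p : heis_orb p p.
Proof. by exists 1%g; rewrite heis_act1. Qed.

Lemma heis_orb_sym p q : heis_orb p q -> heis_orb q p.
Proof. by move=> [g ->]; exists g^-1%g; rewrite -heis_actM mulVg heis_act1. Qed.

Lemma heis_orb_trans p q r : heis_orb p q -> heis_orb q r -> heis_orb p r.
Proof. by move=> [g ->] [h ->]; exists (g * h)%g; rewrite heis_actM. Qed.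

Lemma chart_shift t s v k : heis_orb (chart (t, s, v + k%:~R)) (chart (t, s, v)).
Proof.
by exists ((0, k, 0), 0); rewrite heis_act_t0 /chart; congr (_, _, _); ring.
Qed.

(** The side s = 1 is rotated to the side s = -1, about the fibre over (0, 0) for t <= 1/2 and about
    the fibre over (1/2, 1/2) for t >= 1/2. The first term of [chart_y] is what keeps [v] unchanged
    in the second case. *)
Lemma chart_flip t v : heis_orb (chart (t, -1, v)) (chart (t, 1, v)).
Proof.
have [t2|/ltW t2] := lerP t 2^-1.
  exists ((0, 0, 0), 1); rewrite /chart heis_act_t1.
  have [-> -> ->] := chart_lowE (-1) t2; have [-> -> ->] := chart_lowE 1 t2.
  by congr (_, _, _); field.
exists ((0, 0, 1), 3%:R); rewrite /chart heis_act_t3.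
have [-> -> ->] := chart_highE (-1) t2; have [-> -> ->] := chart_highE 1 t2.
by congr (_, _, _); field.
Qed.

Lemma chart_axis s v : chart (0, s, v) = chart (0, 0, v).
Proof.
have t0 : 0 <= 2^-1 :> R by lra.
rewrite /chart; have [-> -> ->] := chart_lowE s t0; have [-> -> ->] := chart_lowE 0 t0.
by congr (_, _, _); field.
Qed.

(** The remainders -2 and -1, in place of 2 and 3, match the shifts by -1/2 and -1/4 that the second
    and third powers of the rotation produce in [chart_tip]. *)
Lemma int_mod4 k : exists b,
  [\/ k = 4 * b, k = 4 * b + 1, k = 4 * b - 2 | k = 4 * b - 1].
Proof.
have [b [r [kE r0]]] : exists b r : int, k = 4 * b + r /\ (-2 <= r <= 1)%R.
  by exists (divz (k + 2) 4), (modz (k + 2) 4 - 2); lia.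
exists b; have : r = 0 \/ r = 1 \/ r = -2 \/ r = -1 by lia.
by case=> [|[|[]]] rE; [constructor 1|constructor 2|constructor 3|constructor 4]; lia.
Qed.

(** The fibre over (1/2, 1/2) has the coordinate v + (s + 1)/8. The powers of the rotation about it,
    combined with central translations, shift it by all multiples of 1/4. *)
Lemma chart_tip s v s' v' k : v + s / 8 = v' + s' / 8 + k%:~R / 4 ->
  heis_orb (chart (1, s, v)) (chart (1, s', v')).
Proof.
rewrite /chart; have [-> -> ->] := chart_1E s; have [-> -> ->] := chart_1E s'.
move=> E; have [b [] kE] := int_mod4 k; rewrite kE ?(intrD, intrM, rmorphN) /= in E.
- by exists ((0, b, 0), 0); rewrite heis_act_t0; congr (_, _, _); lra.
- by exists ((1, b, 0), 1); rewrite heis_act_t1; congr (_, _, _); lra.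
- by exists ((1, b, 1), 2%:R); rewrite heis_act_t2; congr (_, _, _); lra.
- by exists ((0, b, 1), 3%:R); rewrite heis_act_t3; congr (_, _, _); lra.
Qed.

Lemma round_off x : exists k, `|k%:~R + x| <= 2^-1.
Proof.
exists (- Num.floor (x + 2^-1)); have := floor_itv (x + 2^-1).
by rewrite intrD rmorphN/= => /andP[h1 h2]; rewrite ler_norml; apply/andP; split; lra.
Qed.

(** Integer translations bring x and z into [-1/2, 1/2]; a power of the rotation then makes both
    nonnegative. *)
Lemma square_orb p : exists x y z,
  [/\ 0 <= x <= 2^-1, 0 <= z <= 2^-1 & heis_orb p (x, y, z)].
Proof.
case: p => [[x y] z]; have [a] := round_off x; have [c] := round_off z.
rewrite !ler_norml => /andP[z0 z1] /andP[x0 x1].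
suff [x' [y' [z' [hx hz o]]]] : exists x' y' z', [/\ 0 <= x' <= 2^-1, 0 <= z' <= 2^-1 &
    heis_orb (act ((a, 0, c), 0) (x, y, z)) (x', y', z')].
  exists x', y', z'; split=> //; apply: heis_orb_trans o; apply: heis_orb_sym.
  by exists ((a, 0, c), 0).
rewrite heis_act_t0; move: (_ + x) (_ + y + _) (_ + z) x0 x1 z0 z1.
move=> {}x {}y {}z x0 x1 z0 z1.
suff [g h] : exists g, 0 <= (act g (x, y, z)).1.1 <= 2^-1 /\ 0 <= (act g (x, y, z)).2 <= 2^-1.
  move: h; case E : (act g (x, y, z)) => [[x' y'] z'] /= [hx hz].
  by exists x', y', z'; split=> //; apply: heis_orb_sym; exists g.
have [hx|hx] := lerP 0 x; have [hz|hz] := lerP 0 z.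
- by exists ((0, 0, 0), 0); rewrite heis_act_t0; split; apply/andP; split=> /=; lra.
- by exists ((0, 0, 0), 1); rewrite heis_act_t1; split; apply/andP; split=> /=; lra.
- by exists ((0, 0, 0), 3%:R); rewrite heis_act_t3; split; apply/andP; split=> /=; lra.
- by exists ((0, 0, 0), 2%:R); rewrite heis_act_t2; split; apply/andP; split=> /=; lra.
Qed.

Lemma chart_onto_square x y z : 0 <= x <= 2^-1 -> 0 <= z <= 2^-1 ->
  exists t s v, [/\ 0 <= t <= 1, -1 <= s <= 1 & (x, y, z) = chart (t, s, v)].
Proof.
move=> /andP[x0 x1] /andP[z0 z1]; pose t := x + z.
pose m := 2^-1 - `|t - 2^-1|.
have hm : `|x - z| <= m.
  rewrite ler_norml /m /t; have [h|h] := ger0P (x + z - 2^-1);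
  by apply/andP; split; lra.
have [s [s1 sE]] : exists s, `|s| <= 1 /\ s * m = x - z.
  have [m0|m0] := eqVneq m 0.
    exists 0; rewrite normr0 ler01 mul0r; split=> //; apply/esym/eqP.
    by rewrite -normr_le0 -m0.
  exists ((x - z) / m); rewrite divfK//; split=> //.
  have mp : 0 < m by rewrite lt_neqAle eq_sym m0 (le_trans _ hm).
  by rewrite normrM normfV (gtr0_norm mp) ler_pdivrMr// mul1r.
exists t, s, (y - chart_y t s).
rewrite -ler_norml s1; split; [rewrite /t; lra|by []|].
rewrite /chart /chart_x /chart_z -/m sE /t; congr (_, _, _); lra.
Qed.

Lemma chart_cover p : exists t s v,
  [/\ 0 <= t <= 1, -1 <= s <= 1, 0 <= v <= 1 & heis_orb p (chart (t, s, v))].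
Proof.
have [x [y [z [hx hz o]]]] := square_orb p.
have [t [s [v [ht hs E]]]] := chart_onto_square y hx hz.
have /andP[v0 v1] := floor_itv v; rewrite intrD in v1.
exists t, s, (v - (Num.floor v)%:~R); split=> //; first lra.
apply: heis_orb_trans o _; rewrite E -{1}(subrK (Num.floor v)%:~R v).
exact: chart_shift.
Qed.

End Orbits.

(** * The map to the sphere *)

Section SphereMap.
Context (R : realType).
Implicit Types (x y z t s v a b c d : R) (k : int).
Local Notation turn u := (pi *+ 2 * u).

Lemma cos_turnD v k : cos (turn (v + k%:~R)) = cos (turn v) :> R.
Proof.
have per n w : cos (turn (w + n%:R)) = cos (turn w) :> R.
  by rewrite mulrDr mulr_natr (periodicn (@cosD2pi R)).
case: k => n; first exact: per.
by rewrite NegzE rmorphN/= -(per n.+1 (v - _)) subrK.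
Qed.

Lemma sin_turnD v k : sin (turn (v + k%:~R)) = sin (turn v) :> R.
Proof.
have per n w : sin (turn (w + n%:R)) = sin (turn w) :> R.
  by rewrite mulrDr mulr_natr (periodicn (@sinD2pi R)).
case: k => n; first exact: per.
by rewrite NegzE rmorphN/= -(per n.+1 (v - _)) subrK.
Qed.

(** For u = v - v' the cosine of 2 pi u is 1, so the sine of pi u vanishes, and pi |u| < pi leaves
    only u = 0. *)
Lemma turn_inj v v' : `|v - v'| < 1 ->
  cos (turn v) = cos (turn v') -> sin (turn v) = sin (turn v') -> v = v'.
Proof.
move=> vv' cE sE; apply/eqP; rewrite -subr_eq0; apply/eqP.
have : cos (turn (v - v')) = 1 :> R by rewrite mulrBr cosB cE sE -!expr2 cos2Dsin2.
rewrite mulrnAl cos_mulr2n => c1.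
have : sin (pi * `|v - v'|) ^+ 2 = 0.
  have E : sin (pi * (v - v')) ^+ 2 = 0 by rewrite sin2cos2; lra.
  by have [h|h] := ger0P (v - v') => //; rewrite mulrN sinN sqrrN.
move=> /eqP; rewrite sqrf_eq0 => /eqP s0; apply/eqP; rewrite -normr_eq0.
apply/negPn/negP => n0.
have np : 0 < `|v - v'| by rewrite lt_neqAle eq_sym n0 normr_ge0.
suff /sin_gt0_pi : 0 < pi * `|v - v'| < pi by rewrite s0 ltxx.
have p0 := pi_gt0 R.
by apply/andP; split; [rewrite mulr_gt0|rewrite -[ltRHS]mulr1 ltr_pM2l].
Qed.

Lemma polar x y : exists v, x = Num.sqrt (x ^+ 2 + y ^+ 2) * cos (turn v) /\
  y = Num.sqrt (x ^+ 2 + y ^+ 2) * sin (turn v).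
Proof.
set r := Num.sqrt _; have r2 : r ^+ 2 = x ^+ 2 + y ^+ 2.
  by rewrite sqr_sqrtr// addr_ge0// sqr_ge0.
have [r0|r0] := eqVneq r 0.
  move: r2; rewrite r0 expr0n/= => /esym/eqP; rewrite paddr_eq0 ?sqr_ge0// !sqrf_eq0.
  by move=> /andP[/eqP -> /eqP ->]; exists 0; rewrite !mul0r.
have rp : 0 < r by rewrite lt_neqAle eq_sym r0 sqrtr_ge0.
have h1 : (x / r) ^+ 2 + (y / r) ^+ 2 = 1.
  by rewrite !expr_div_n -mulrDl -r2 divff// sqrf_eq0.
have xr : -1 <= x / r <= 1.
  by rewrite -ler_norml -(@expr_le1 _ 2)// real_normK ?num_real// -h1 lerDl sqr_ge0.
have pi0 : pi *+ 2 != 0 :> R by rewrite mulrn_eq0 /= gt_eqF// pi_gt0.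
(* [acos] gives the angle up to sign, and the sign of [y] decides. *)
have [u [cu su]] : exists u : R, cos u = x / r /\ sin u = y / r.
  have ya : `|y / r| = Num.sqrt (1 - (x / r) ^+ 2) by rewrite -h1 addrC addKr sqrtr_sqr.
  have [y0|y0] := ger0P (y / r).
    by exists (acos (x / r)); rewrite acosK ?in_itv//= sin_acos// -ya ger0_norm.
  exists (- acos (x / r)); rewrite cosN sinN acosK ?in_itv//= sin_acos// -ya.
  by rewrite ltr0_norm// opprK.
exists (u / (pi *+ 2)); rewrite [pi *+ 2 * _]mulrC divfK// cu su.
by rewrite mulrC divfK// mulrC divfK.
Qed.

Definition vec4 (a b c d : R) : 'rV[R]_4 := \row_i nth 0 [:: a; b; c; d] i.

Lemma vec4_inj a b c d a' b' c' d' : vec4 a b c d = vec4 a' b' c' d' ->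
  [/\ a = a', b = b', c = c' & d = d'].
Proof.
move=> E.
have h (k : nat) (k4 : (k < 4)%N) := congr1 (fun u : 'rV_4 => u ord0 (Ordinal k4)) E.
by have := h 0%N isT; have := h 1%N isT; have := h 2%N isT; have := h 3%N isT; rewrite !mxE.
Qed.

Lemma vec4E (u : 'rV[R]_4) : exists a b c d, u = vec4 a b c d.
Proof.
exists (u ord0 (inord 0)), (u ord0 (inord 1)), (u ord0 (inord 2)), (u ord0 (inord 3)).
apply/rowP => -[[|[|[|[|//]]]] i4]; rewrite !mxE /=; congr (u _ _);
  by apply: val_inj; rewrite /= inordK.
Qed.

Lemma sphere_vec4 a b c d :
  unit_sphere R 4 (vec4 a b c d) <-> a ^+ 2 + b ^+ 2 + c ^+ 2 + d ^+ 2 = 1.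
Proof.
by rewrite /unit_sphere /= !big_ord_recl big_ord0 !mxE /= addr0 !addrA.
Qed.

Definition sphere_map (c : R * R * R) : 'rV[R]_4 := let: (t, s, v) := c in
  let w := v * 4 + s / 2 in
  vec4 (Num.sqrt (1 - t) * cos (turn v)) (Num.sqrt (1 - t) * sin (turn v))
       (Num.sqrt t * cos (turn w)) (Num.sqrt t * sin (turn w)).

Lemma sum_sqr_polar x y : (x * cos y) ^+ 2 + (x * sin y) ^+ 2 = x ^+ 2.
Proof. by rewrite !exprMn -mulrDr cos2Dsin2 mulr1. Qed.

Lemma sphere_map_sphere t s v : 0 <= t <= 1 -> unit_sphere R 4 (sphere_map (t, s, v)).
Proof.
move=> /andP[t0 t1]; rewrite sphere_vec4 -[LHS]addrA !sum_sqr_polar !sqr_sqrtr//; lra.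
Qed.

(** [t] is the squared modulus of the second complex coordinate; the argument of the first gives
    [v], that of the second then gives [s]. Where a modulus vanishes, [strict_chart] prescribes the
    lost parameter. *)
Lemma sphere_map_inj t s v t' s' v' :
  strict_chart (t, s, v) -> strict_chart (t', s', v') ->
  sphere_map (t, s, v) = sphere_map (t', s', v') -> (t, s, v) = (t', s', v').
Proof.
move=> [/andP[t0 t1] /andP[s0 s1] /andP[v0 v1] ts tv].
move=> [/andP[t0' t1'] /andP[s0' s1'] /andP[v0' v1'] ts' tv'] /vec4_inj[E0 E1 E2 E3].
have tE : t = t'.
  rewrite -(sqr_sqrtr t0) -(sqr_sqrtr t0').
  by rewrite -(sum_sqr_polar _ (turn (v * 4 + s / 2))) E2 E3 sum_sqr_polar.
subst t'.
have vE : v = v'.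
  have [t10|t1n] := eqVneq t 1; first by rewrite tv// tv'.
  have A0 : Num.sqrt (1 - t) != 0 by rewrite gt_eqF// sqrtr_gt0 subr_gt0 lt_neqAle t1n.
  apply: turn_inj (mulfI A0 E0) (mulfI A0 E1).
  by rewrite ltr_norml; apply/andP; split; lra.
subst v'; have [t00|t0n] := eqVneq t 0; first by rewrite ts// ts'.
have B0 : Num.sqrt t != 0 by rewrite gt_eqF// sqrtr_gt0 lt_neqAle eq_sym t0n.
suff : v * 4 + s / 2 = v * 4 + s' / 2 by move=> ?; congr (_, _, _); lra.
apply: turn_inj (mulfI B0 E2) (mulfI B0 E3).
by rewrite ltr_norml; apply/andP; split; lra.
Qed.

Lemma sphere_map_onto u : unit_sphere R 4 u ->
  exists t s v, [/\ 0 <= t <= 1, -1 <= s <= 1, 0 <= v <= 1 & sphere_map (t, s, v) = u].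
Proof.
have [a [b [c [d ->]]]] := vec4E u; rewrite sphere_vec4 => E.
have [v1 [aE bE]] := polar a b; have [w [cE dE]] := polar c d.
have a2 := sqr_ge0 a; have b2 := sqr_ge0 b; have c2 := sqr_ge0 c; have d2 := sqr_ge0 d.
have [k1 hk1] : exists k, 0 <= v1 + k%:~R <= 1.
  exists (- Num.floor v1); have := floor_itv v1; rewrite intrD rmorphN/=; lra.
pose v := v1 + k1%:~R; have [k hk] := round_off (w - v * 4).
(* [s] solves 4v + s/2 = w + k, with [k] chosen to bring it into [-1, 1]. *)
exists (c ^+ 2 + d ^+ 2), ((k%:~R + (w - v * 4)) * 2), v; split=> //.
- by lra.
- by move: hk; rewrite ler_norml; lra.
rewrite /sphere_map (_ : 1 - (_ + _) = a ^+ 2 + b ^+ 2); last by lra.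
rewrite (_ : v * 4 + _ = w + k%:~R); last by lra.
by rewrite cos_turnD sin_turnD cos_turnD sin_turnD -aE -bE -cE -dE.
Qed.

Lemma sphere_map_shift t s v k : sphere_map (t, s, v + k%:~R) = sphere_map (t, s, v).
Proof.
rewrite /sphere_map cos_turnD sin_turnD.
rewrite (_ : _ * 4 + _ = v * 4 + s / 2 + (k * 4)%:~R).
  by rewrite cos_turnD sin_turnD.
by rewrite intrM; lra.
Qed.

Lemma sphere_map_flip t v : sphere_map (t, 1, v) = sphere_map (t, -1, v).
Proof.
rewrite /sphere_map (_ : v * 4 + 1 / 2 = v * 4 + -1 / 2 + 1%:~R); last by lra.
by rewrite cos_turnD sin_turnD.
Qed.

Lemma sphere_map_axis s v : sphere_map (0, s, v) = sphere_map (0, 0, v).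
Proof. by rewrite /sphere_map sqrtr0 !mul0r. Qed.

Lemma sphere_map_tip s v s' v' k : v + s / 8 = v' + s' / 8 + k%:~R / 4 ->
  sphere_map (1, s, v) = sphere_map (1, s', v').
Proof.
move=> E; rewrite /sphere_map subrr sqrtr0 !mul0r.
rewrite (_ : v * 4 + _ = v' * 4 + s' / 2 + k%:~R); last by lra.
by rewrite cos_turnD sin_turnD.
Qed.

(** Orbits and [sphere_map] obey the same gluing relations on the box, so one normal form serves
    both. *)
Lemma strict_chart_exists t s v : 0 <= t <= 1 -> -1 <= s <= 1 ->
  exists c : R * R * R, [/\ strict_chart c, heis_orb (chart (t, s, v)) (chart c) &
    sphere_map (t, s, v) = sphere_map c].
Proof.
move=> ht hs.
have [vb] : exists b : int, 0 <= v + b%:~R < 1.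
  exists (- Num.floor v); have := floor_itv v; rewrite intrD rmorphN/=; lra.
move=> hv.
have [->|t1] := eqVneq t 1.
  (* With this [k], 4v + s/2 - k lies in ]-1/2, 1/2]; its double is the new [s]. *)
  pose k := Num.ceil (v * 4 + s / 2 - 2^-1).
  exists (1, 8 * v + s - k%:~R * 2, 0).
  have E : v + s / 8 = 0 + (8 * v + s - k%:~R * 2) / 8 + k%:~R / 4 by lra.
  split; [|exact: chart_tip E|exact: sphere_map_tip E].
  have := ceil_itv (v * 4 + s / 2 - 2^-1); rewrite -/k intrD rmorphN/= => /andP[k0 k1].
  by split; [lra|apply/andP; split; lra|lra|lra|].
have [->|t0] := eqVneq t 0.
  exists (0, 0, v + vb%:~R); split.
  - by split=> //; lra.
  - by rewrite chart_axis; apply: heis_orb_sym; exact: chart_shift.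
  - by rewrite sphere_map_shift sphere_map_axis.
have [->|s1] := eqVneq s (-1).
  exists (t, 1, v + vb%:~R); split.
  - by split=> //; [lra|move=> t00; case/eqP: t0|move=> t11; case/eqP: t1].
  - by apply: heis_orb_trans (chart_flip _ _) _; apply: heis_orb_sym; exact: chart_shift.
  - by rewrite sphere_map_shift sphere_map_flip.
exists (t, s, v + vb%:~R); split.
- split=> //; [|by move=> t00; case/eqP: t0|by move=> t11; case/eqP: t1].
  by case/andP: hs => s0 ->; rewrite lt_neqAle eq_sym s1 s0.
- by apply: heis_orb_sym; exact: chart_shift.
- by rewrite sphere_map_shift.
Qed.

(** Both sides amount to equality of the normal forms, by [strict_chart_orbit] and by
    [sphere_map_inj]. *)
Lemma sphere_map_orbP t s v t' s' v' : 0 <= t <= 1 -> -1 <= s <= 1 ->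
  0 <= t' <= 1 -> -1 <= s' <= 1 ->
  heis_orb (chart (t, s, v)) (chart (t', s', v')) <->
  sphere_map (t, s, v) = sphere_map (t', s', v').
Proof.
move=> ht hs ht' hs'.
have [[[t1 s1] v1] [sc1 o1 f1]] := strict_chart_exists v ht hs.
have [[[t2 s2] v2] [sc2 o2 f2]] := strict_chart_exists v' ht' hs'.
rewrite f1 f2; split=> [pq|fE].
  have [g gE] : heis_orb (chart (t1, s1, v1)) (chart (t2, s2, v2)).
    exact: heis_orb_trans (heis_orb_sym o1) (heis_orb_trans pq o2).
  by have [-> _ _] := strict_chart_orbit sc2 sc1 (esym gE).
apply: heis_orb_trans o1 _; rewrite (sphere_map_inj sc1 sc2 fE).
exact: heis_orb_sym.
Qed.

End SphereMap.

(** * Topology of the Heisenberg group *)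

Section ContinuityRules.
Context (R : realType) (T : topologicalType).
Implicit Types f g : T -> R.

Lemma continuous_add f g : continuous f -> continuous g -> continuous (fun x => f x + g x).
Proof. by move=> cf cg x; apply: (@cvgD _ _ _ (nbhs x)); [exact: cf|exact: cg]. Qed.

Lemma continuous_sub f g : continuous f -> continuous g -> continuous (fun x => f x - g x).
Proof. by move=> cf cg x; apply: (@cvgB _ _ _ (nbhs x)); [exact: cf|exact: cg]. Qed.

Lemma continuous_mul f g : continuous f -> continuous g -> continuous (fun x => f x * g x).
Proof. by move=> cf cg x; apply: (@cvgM _ _ (nbhs x)); [exact: cf|exact: cg]. Qed.

Lemma continuous_norm f : continuous f -> continuous (fun x => `|f x|).
Proof. by move=> cf x; apply: (continuous_comp (cf x)); exact: norm_continuous. Qed.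

Lemma continuous_rV n (f : T -> 'rV[R]_n) :
  (forall i, continuous (fun x => f x ord0 i)) -> continuous f.
Proof.
move=> cf x V [P Pnbhs PV].
have : \forall y \near x, forall i, P ord0 i (f y ord0 i).
  by apply: filter_forall => i; apply: cf; exact: Pnbhs.
by apply: filterS => y Py; apply: PV => i j; rewrite (ord1 i).
Qed.

Lemma continuous_pair (U V : topologicalType) (f : T -> U) (g : T -> V) :
  continuous f -> continuous g -> continuous (fun x => (f x, g x)).
Proof. by move=> cf cg x; exact: cvg_pair (cf x) (cg x). Qed.

End ContinuityRules.

Ltac continuity := lazymatch goal with
  | |- forall _, continuous_at _ (fun _ => ?c) => exact: cst_continuous
  | |- forall _, continuous_at _ (fun x => GRing.add (@?f x) (GRing.opp (@?g x))) =>
      apply: (@continuous_sub _ _ f g); continuity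
  | |- forall _, continuous_at _ (fun x => GRing.add (@?f x) (@?g x)) =>
      apply: (@continuous_add _ _ f g); continuity
  | |- forall _, continuous_at _ (fun x => GRing.mul (@?f x) (@?g x)) =>
      apply: (@continuous_mul _ _ f g); continuity
  | |- forall _, continuous_at _ (fun x => Num.norm (@?f x)) =>
      apply: (@continuous_norm _ _ f); continuity
  | |- _ => try assumption
  end.

Section HeisTopology.
Context (R : realType).
Implicit Types (t s v : R) (p q : heis R).
Local Notation act := (@heis_act R).

Lemma heis_hausdorff : hausdorff_space (heis R).
Proof. exact: (@norm_hausdorff R (R * R * R)%type). Qed.

Lemma triple_continuous :
  [/\ continuous (fun c : R * R * R => c.1.1), continuous (fun c : R * R * R => c.1.2) &
      continuous (fun c : R * R * R => c.2)].
Proof.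
split=> x; first by apply: cvg_comp; exact: cvg_fst.
  by apply: cvg_comp; [exact: cvg_fst|exact: cvg_snd].
exact: cvg_snd.
Qed.

Lemma chart_continuous : continuous (@chart R : R * R * R -> heis R).
Proof.
have [c1 c2 c3] := triple_continuous.
have -> : @chart R = fun c => (chart_x c.1.1 c.1.2, c.2 + chart_y c.1.1 c.1.2,
    chart_z c.1.1 c.1.2) by apply/funext => -[[t s] v].
rewrite /chart_y /chart_x /chart_z.
by apply: continuous_pair; [apply: continuous_pair|]; continuity.
Qed.

Lemma sphere_map_continuous : continuous (@sphere_map R).
Proof.
have [c1 c2 c3] := triple_continuous.
have cs := @continuous_sin R; have cc := @continuous_cos R; have cr := @sqrt_continuous R.
have comp f (g : R * R * R -> R) : continuous (f : R -> R) -> continuous g ->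
    continuous (fun c => f (g c)).
  by move=> cf cg x; apply: (continuous_comp (cg x)); exact: cf.
apply: continuous_rV => i; pose w (c : R * R * R) : R := c.2 * 4 + c.1.2 / 2.
have cw : continuous w by rewrite /w; continuity.
have -> : (fun c => sphere_map c ord0 i) = fun c : R * R * R => nth 0 [::
   Num.sqrt (1 - c.1.1) * cos (pi *+ 2 * c.2); Num.sqrt (1 - c.1.1) * sin (pi *+ 2 * c.2);
   Num.sqrt c.1.1 * cos (pi *+ 2 * w c); Num.sqrt c.1.1 * sin (pi *+ 2 * w c)] i.
  by apply/funext => -[[t s] v]; rewrite mxE.
by case: i => -[|[|[|[|//]]]] /= _; apply: continuous_mul; apply: comp => //; continuity.
Qed.

Definition chart_cube : set (R * R * R) :=
  [set c | [/\ 0 <= c.1.1 <= 1, -1 <= c.1.2 <= 1 & 0 <= c.2 <= 1]].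

Lemma chart_cube_compact : compact chart_cube.
Proof.
have -> : chart_cube = `[0, 1] `*` `[-1, 1] `*` `[0, 1].
  by apply/seteqP; split=> [[[t s] v] [/= h1 h2 h3]|[[t s] v] [[/= h1 h2] h3]];
    rewrite /= !in_itv/= in h1 h2 h3 *.
by apply: compact_setX; [apply: compact_setX|]; exact: segment_compact.
Qed.

Definition heis_box (M : R) : set (heis R) :=
  [set p | [/\ `|p.1.1| <= M, `|p.1.2| <= M & `|p.2| <= M]].

Lemma chart_box c : chart_cube c -> heis_box 2 (chart c).
Proof.
case: c => [[t s] v] [/= /andP[t0 t1] /andP[s0 s1] /andP[v0 v1]].
have [hx hz] : 0 <= chart_x t s <= 2^-1 /\ 0 <= chart_z t s <= 2^-1.
  have [t2|/ltW t2] := lerP t 2^-1.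
    have [-> -> _] := chart_lowE s t2.
    have p1 : 0 <= t * (1 + s) by apply: mulr_ge0; lra.
    have p2 : 0 <= t * (1 - s) by apply: mulr_ge0; lra.
    by split; lra.
  have [-> -> _] := chart_highE s t2.
  have p1 : 0 <= (1 - t) * (1 + s) by apply: mulr_ge0; lra.
  have p2 : 0 <= (1 - t) * (1 - s) by apply: mulr_ge0; lra.
  by split; lra.
have hxz : 0 <= chart_x t s * chart_z t s <= 2^-1 * 2^-1.
  by case/andP: hx => x0 x1; case/andP: hz => z0 z1; rewrite mulr_ge0//= ler_pM.
have he : 0 <= t - 2^-1 + `|t - 2^-1| <= 1 by have [h|h] := ger0P (t - 2^-1); lra.
have hs : `|s * (t - 2^-1 + `|t - 2^-1|)| <= 1 * 1.
  by case/andP: he => e0 e1; rewrite normrM ler_pM// ler_norml; lra.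
rewrite ler_norml in hs.
by split; rewrite /= ler_norml ?/chart_y; lra.
Qed.

Lemma heis_box_nbhs p : exists2 M, 2 <= M & nbhs p (heis_box M).
Proof.
have c1 := @heis_coord1_continuous R; have c2 := @heis_coord2_continuous R.
have c3 := @heis_coord3_continuous R.
have a1 := normr_ge0 p.1.1; have a2 := normr_ge0 p.1.2; have a3 := normr_ge0 p.2.
pose M := 2 + `|p.1.1| + `|p.1.2| + `|p.2|; exists M; first by rewrite /M; lra.
have lt (f : heis R -> R) : continuous f -> `|f p| < M -> \forall q \near p, `|f q| <= M.
  move=> cf fpM; have := cf p.
  move=> /(@cvgr_norm_le _ _ _ (nbhs p)); exact.
have h1 := lt _ c1 ltac:(rewrite /M; lra); have h2 := lt _ c2 ltac:(rewrite /M; lra).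
have h3 := lt _ c3 ltac:(rewrite /M; lra).
apply: filterS (filterI h1 (filterI h2 h3)).
by move=> q [? [? ?]]; split.
Qed.

Lemma finite_int_ball (M : R) : finite_set [set k : int | `|k%:~R| <= M].
Proof.
have [N MN] : exists N : nat, M <= N%:R.
  exists (Num.bound `|M|); apply: le_trans (ler_norm M) (ltW _).
  exact: archi_boundP.
apply: (@sub_finite_set _ _ [set (m%:Z - N%:Z)%R | m in `I_(N + N).+1]); last first.
  exact/finite_image/finite_II.
move=> k /= /le_trans/(_ MN); rewrite -intr_norm -[N%:R]/(N%:Z%:~R) ler_int => kN.
by exists (absz (k + N%:Z)); lia.
Qed.

(** This is properness of the action: a box bounds the integer entries of every element that moves
    one of its points into it. *)
Lemma heis_act_proper (M : R) :
  finite_set [set g | exists p, heis_box M p /\ heis_box M (act g p)].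
Proof.
(* The bound for [b]: two coordinates contribute 2M, the product of [a] with a coordinate 2M^2, and
   the term xz of the odd rotations M^2. *)
pose B := [set k : int | `|k%:~R| <= M * 2 + M ^+ 2 * 3].
have Bf : finite_set B by exact: finite_int_ball.
have Hf : finite_set (((B `*` B) `*` B) `*` [set: 'Z_4]).
  by apply: finite_setX; [do 2?apply: finite_setX|exact: finite_finset].
apply: sub_finite_set Hf => g [[[x y] z] [[/= px py pz]]].
have M0 : 0 <= M by exact: le_trans px.
have hxz : `|x * z| <= M ^+ 2 by rewrite normrM expr2 ler_pM.
move: px py pz hxz; rewrite !ler_norml => px py pz hxz.
have sub a b c : `|a%:~R : R| <= M * 2 -> `|b%:~R : R| <= M * 2 + M ^+ 2 * 3 ->
    `|c%:~R : R| <= M * 2 -> ((B a /\ B b) /\ B c) /\ True.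
  move=> ha hb hc; have M2 := sqr_ge0 M; split=> //; split; [split=> //|];
  rewrite /B /=; lra.
have M2 := sqr_ge0 M.
have [a [b [c [] ->]]] := heis_Z4_cases g;
  rewrite ?(heis_act_t0, heis_act_t1, heis_act_t2, heis_act_t3) => -[/=].
all: rewrite !ler_norml => hx hy hz.
- have ha : `|a%:~R : R| <= M * 2 by rewrite ler_norml; lra.
  apply: sub => //; last by rewrite ler_norml; lra.
  have : `|a%:~R * z| <= (M * 2) * M by rewrite normrM ler_pM// ler_norml.
  by rewrite !ler_norml => haz; lra.
- have ha : `|a%:~R : R| <= M * 2 by rewrite ler_norml; lra.
  apply: sub => //; last by rewrite ler_norml; lra.
  have : `|a%:~R * x| <= (M * 2) * M by rewrite normrM ler_pM// ler_norml.
  by rewrite !ler_norml => haz; lra.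
- have ha : `|a%:~R : R| <= M * 2 by rewrite ler_norml; lra.
  apply: sub => //; last by rewrite ler_norml; lra.
  have : `|a%:~R * z| <= (M * 2) * M by rewrite normrM ler_pM// ler_norml.
  by rewrite !ler_norml => haz; lra.
- have ha : `|a%:~R : R| <= M * 2 by rewrite ler_norml; lra.
  apply: sub => //; last by rewrite ler_norml; lra.
  have : `|a%:~R * x| <= (M * 2) * M by rewrite normrM ler_pM// ler_norml.
  by rewrite !ler_norml => haz; lra.
Qed.

(** A box containing the image of the cube meets only those translates whose group element moves a
    point of the box into the box. *)
Lemma chart_cube_locally_finite p : exists2 U, nbhs p U &
  finite_set [set g | (U `&` act g @` (@chart R @` chart_cube)) !=set0].
Proof.
have [M M2 pM] := heis_box_nbhs p; exists (heis_box M) => //.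
apply: sub_finite_set (heis_act_proper M) => g [q [qM [r [c cc rE] qE]]].
exists r; rewrite qE; split=> //; rewrite -rE.
by have [? ? ?] := chart_box cc; split; exact: le_trans M2.
Qed.

Lemma heis_isotropy_finite p : finite_set (isotropy (heis_action R) p).
Proof.
have [M _ /nbhs_singleton pM] := heis_box_nbhs p.
apply: sub_finite_set (heis_act_proper M) => g gp; exists p; split=> //.
by rewrite [heis_act g p]gp.
Qed.

End HeisTopology.

(** * The cells *)

Section HeisCells.
Context (R : realType).
Implicit Types (t s v : R) (y : nat -> R) (n i : nat).
Local Notation act := (@heis_act R).

(** The alternating sum 3 - 5 + 3 - 1 = 0 is the Euler characteristic of S^3. The default of [nth]
    excludes cells above dimension 3. *)
Definition cell_count n : nat := nth 0%N [:: 3; 5; 3; 1]%N n.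

(** The i-th n-cell, as a face of the parameter box, with [y] ranging over the cube
   [-1,1]^n. Only the indices [i < cell_count n] are meaningful. *)
Definition cell n i y : R * R * R :=
  let h k := (y k + 1) / 2 in
  match n, i with
  | 0, 0 => (0, 0, 0)
  | 0, 1 => (2^-1, 1, 0)
  | 0, _ => (1, 1, 0)
  | 1, 0 => (h 0%N / 2, 1, 0)
  | 1, 1 => ((1 + h 0%N) / 2, 1, 0)
  | 1, 2 => (0, 0, h 0%N)
  | 1, 3 => (2^-1, 1, h 0%N)
  | 1, _ => (1, y 0%N, 0)
  | 2, 0 => (h 0%N, y 1%N, 0)
  | 2, 1 => (h 0%N / 2, 1, h 1%N)
  | 2, _ => ((1 + h 0%N) / 2, 1, h 1%N)
  | _, _ => (h 0%N, y 1%N, h 2%N)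
  end.

(** Recovering the open cell from its strict parameters shows that distinct open cells have disjoint
    orbits. *)
Definition cell_of (c : R * R * R) : nat * nat := let: (t, s, v) := c in
  if t == 0 then (if v == 0 then (0%N, 0%N) else (1%N, 2%N))
  else if t == 1 then (if s == 1 then (0%N, 2%N) else (1%N, 4%N))
  else if s == 1 then
    (if v == 0 then
       if t < 2^-1 then (1%N, 0%N) else if t == 2^-1 then (0%N, 1%N) else (1%N, 1%N)
     else
       if t < 2^-1 then (2%N, 1%N) else if t == 2^-1 then (1%N, 3%N) else (2%N, 2%N))
  else (if v == 0 then (2%N, 0%N) else (3%N, 0%N)).

Lemma in_cells (P : nat -> nat -> Prop) :
  P 0%N 0%N -> P 0%N 1%N -> P 0%N 2%N ->
  P 1%N 0%N -> P 1%N 1%N -> P 1%N 2%N -> P 1%N 3%N -> P 1%N 4%N ->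
  P 2%N 0%N -> P 2%N 1%N -> P 2%N 2%N -> P 3%N 0%N ->
  forall n i, (i < cell_count n)%N -> P n i.
Proof.
move=> p00 p01 p02 p10 p11 p12 p13 p14 p20 p21 p22 p30 n i.
case: n => [|[|[|[|n]]]]; last by rewrite /cell_count nth_default.
all: by case: i => [|[|[|[|[|i]]]]].
Qed.

Definition open_cube n y := forall k, (k < n)%N -> -1 < y k /\ y k < 1.
Definition closed_cube n y := forall k, (k < n)%N -> -1 <= y k /\ y k <= 1.

Lemma cell_strict n i y : (i < cell_count n)%N -> open_cube n y ->
  strict_chart (cell n i y).
Proof.
move: n i; apply: in_cells => yn.
all: try have [y0 y0'] := yn 0%N isT; try have [y1 y1'] := yn 1%N isT;
  try have [y2 y2'] := yn 2%N isT.
all: by rewrite /=; split; lra.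
Qed.

Lemma cell_ofK n i y : (i < cell_count n)%N -> open_cube n y -> cell_of (cell n i y) = (n, i).
Proof.
move: n i; apply: in_cells => yn.
all: try have [y0 y0'] := yn 0%N isT; try have [y1 y1'] := yn 1%N isT;
  try have [y2 y2'] := yn 2%N isT.
all: rewrite /=.
all: repeat first
  [ case: eqVneq => [?|/eqP];
    [try (exfalso; lra)|let ne := fresh in move=> ne; try (exfalso; apply: ne; lra)]
  | case: ltP => ?; try (exfalso; lra) ].
all: by [].
Qed.

Lemma cell_inj n i y y' : (i < cell_count n)%N -> cell n i y = cell n i y' ->
  forall k, (k < n)%N -> y k = y' k.
Proof.
move: n i; apply: in_cells => /= E; case=> [|[|[|k]]] // _; case: E => *; lra.
Qed.


Lemma cell_continuous (T : topologicalType) n i (y : T -> nat -> R) :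
  (i < cell_count n)%N -> (forall k, continuous (fun x => y x k)) ->
  continuous (fun x => cell n i (y x)).
Proof.
move=> + yc; have c0 := yc 0%N; have c1 := yc 1%N; have c2 := yc 2%N.
by move: n i; apply: in_cells; apply: continuous_pair; try apply: continuous_pair;
  continuity.
Qed.

(** Unless [g] is 1, the given point has t = 0, or t = 1/2 and s = 1. On a cell with such an
    interior point [t] and [s] are constant, so [fixg] covers the whole cell. *)
Lemma cell_fixed n i y t s v g : (i < cell_count n)%N -> open_cube n y ->
  cell n i y = (t, s, v) -> (forall u, act g (chart (t, s, u)) = chart (t, s, u)) ->
  [\/ g = 1%g, t = 0 | t = 2^-1 /\ s = 1] ->
  forall y', act g (chart (cell n i y')) = chart (cell n i y').
Proof.
move=> + + + fixg g1; move: n i; apply: in_cells => yn.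
all: try have [y0 y0'] := yn 0%N isT; try have [y1 y1'] := yn 1%N isT;
  try have [y2 y2'] := yn 2%N isT.
all: case=> tE sE vE y'; subst t s v; case: g1 => [->|t0|[th s1]].
all: try exact: heis_act1.
all: try exact: fixg.
all: exfalso; lra.
Qed.

Definition in_lower_cell n (c : R * R * R) : Prop := exists m j y,
  [/\ (m < n)%N, (j < cell_count m)%N, closed_cube m y &
      heis_orb (chart c) (chart (cell m j y))].

Lemma in_lower_cell_orb n c c' :
  heis_orb (chart c) (chart c') -> in_lower_cell n c' -> in_lower_cell n c.
Proof.
move=> o [m [j [y [mn jm yc o']]]]; exists m, j, y; split=> //.
exact: heis_orb_trans o'.
Qed.

Lemma in_lower_cellE n m j y c : (m < n)%N -> (j < cell_count m)%N ->
  closed_cube m y -> cell m j y = c -> in_lower_cell n c.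
Proof. by move=> mn jm yc <-; exists m, j, y; split=> //; exact: heis_orb_refl. Qed.

Lemma chart_1_0 t s : heis_orb (chart (t, s, 1)) (chart (t, s, 0)).
Proof. by have := chart_shift t s 0 1; rewrite add0r. Qed.

Lemma side_in_lower t v : 0 <= t <= 1 -> 0 <= v <= 1 -> in_lower_cell 3 (t, 1, v).
Proof.
move=> ht hv; have [h|h] := lerP t 2^-1.
  apply: (@in_lower_cellE 3 2 1 (fun k => nth 0 [:: 4 * t - 1; 2 * v - 1] k)) => //.
    by case=> [|[|//]] _ /=; lra.
  by rewrite /=; congr (_, _, _); lra.
apply: (@in_lower_cellE 3 2 2 (fun k => nth 0 [:: 4 * t - 3; 2 * v - 1] k)) => //.
  by case=> [|[|//]] _ /=; lra.
by rewrite /=; congr (_, _, _); lra.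
Qed.

Lemma edge_in_lower t : 0 <= t <= 1 -> in_lower_cell 2 (t, 1, 0).
Proof.
move=> ht; have [h|h] := lerP t 2^-1.
  apply: (@in_lower_cellE 2 1 0 (fun k => 4 * t - 1)) => //; first by case=> // _; lra.
  by rewrite /=; congr (_, _, _); lra.
apply: (@in_lower_cellE 2 1 1 (fun k => 4 * t - 3)) => //; first by case=> // _; lra.
by rewrite /=; congr (_, _, _); lra.
Qed.

Lemma tip_in_lower s : -1 <= s <= 1 -> in_lower_cell 2 (1, s, 0).
Proof.
by move=> hs; apply: (@in_lower_cellE 2 1 4 (fun=> s)) => //; case=> // _; lra.
Qed.

Lemma axis_in_lower v : 0 <= v <= 1 -> in_lower_cell 2 (0, 0, v).
Proof.
move=> hv; apply: (@in_lower_cellE 2 1 2 (fun=> 2 * v - 1)) => //.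
  by case=> // _; lra.
by rewrite /=; congr (_, _, _); lra.
Qed.

Lemma half_in_lower v : 0 <= v <= 1 -> in_lower_cell 2 (2^-1, 1, v).
Proof.
move=> hv; apply: (@in_lower_cellE 2 1 3 (fun=> 2 * v - 1)) => //.
  by case=> // _; lra.
by rewrite /=; congr (_, _, _); lra.
Qed.

Lemma cube_boundary_in_lower t s v : 0 <= t <= 1 -> -1 <= s <= 1 -> 0 <= v <= 1 ->
  t = 0 \/ t = 1 \/ s = -1 \/ s = 1 \/ v = 0 \/ v = 1 -> in_lower_cell 3 (t, s, v).
Proof.
move=> ht hs hv; have bottom : in_lower_cell 3 (t, s, 0).
  apply: (@in_lower_cellE 3 2 0 (fun k => nth 0 [:: 2 * t - 1; s] k)) => //.
    by case=> [|[|//]] _ /=; lra.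
  by rewrite /=; congr (_, _, _); lra.
case=> [t0|[t1|[s0|[s1|[v0|v1]]]]].
- subst t; have E : chart (0, s, v) = chart (0, 1, v) by rewrite chart_axis [RHS]chart_axis.
  apply: (@in_lower_cell_orb _ _ (0, 1, v)); first by rewrite E; exact: heis_orb_refl.
  exact: side_in_lower.
(* At t = 1 one can pass to s = 1 by adding (s - 1)/8 to [v]; should the result be negative, the tip
   relation allows adding 1/4. *)
- subst t; have [h|h] := lerP 0 (v + (s - 1) / 8).
    apply: (@in_lower_cell_orb _ _ (1, 1, v + (s - 1) / 8)).
      by apply: (@chart_tip R _ _ _ _ 0); lra.
    by apply: side_in_lower => //; lra.
  apply: (@in_lower_cell_orb _ _ (1, 1, v + (s - 1) / 8 + 4^-1)).
    by apply: (@chart_tip R _ _ _ _ (-1)); rewrite rmorphN1; lra.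
  by apply: side_in_lower => //; lra.
- by subst s; apply: in_lower_cell_orb (chart_flip _ _) _; exact: side_in_lower.
- by subst s; exact: side_in_lower.
- by subst v.
- by subst v; apply: in_lower_cell_orb (chart_1_0 _ _) _.
Qed.

Lemma cell_boundary n i y : (i < cell_count n)%N -> closed_cube n y ->
  (exists k, (k < n)%N /\ `|y k| = 1) -> in_lower_cell n (cell n i y).
Proof.
have cases x : `|x| = 1 -> x = -1 \/ x = 1 :> R.
  by have [_ ->|_ E] := ger0P x; [right|left; lra].
have zero_axis v : heis_orb (chart (0, 1, v)) (chart (0, 0, v)).
  by rewrite chart_axis; exact: heis_orb_refl.
have low1 j (j3 : (j < 3)%N) c : cell 0 j (fun=> 0) = c -> in_lower_cell 1 c.
  exact: (@in_lower_cellE 1 0).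
move: n i; apply: in_cells => yn [k [kn /cases yk]].
all: try have [y0 y0'] := yn 0%N isT; try have [y1 y1'] := yn 1%N isT;
  try have [y2 y2'] := yn 2%N isT.
all: case: k kn yk => [|[|[|//]]] //= _ yk.
- case: yk => ->; rewrite /=.
    apply: (@in_lower_cell_orb _ _ (0, 0, 0)); last exact: (low1 0%N).
    by rewrite addNr !mul0r; exact: zero_axis.
  by apply: (low1 1%N) => //=; congr (_, _, _); lra.
- case: yk => ->; first by apply: (low1 1%N) => //=; congr (_, _, _); lra.
  by apply: (low1 2%N) => //=; congr (_, _, _); lra.
- case: yk => ->; first by apply: (low1 0%N) => //=; congr (_, _, _); lra.
  apply: (@in_lower_cell_orb _ _ (0, 0, 0)); last exact: (low1 0%N).
  by rewrite (_ : (1 + 1) / 2 = 1); [exact: chart_1_0|lra].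
- case: yk => ->; first by apply: (low1 1%N) => //=; congr (_, _, _); lra.
  apply: (@in_lower_cell_orb _ _ (2^-1, 1, 0)); last exact: (low1 1%N).
  by rewrite (_ : (1 + 1) / 2 = 1); [exact: chart_1_0|lra].
- case: yk => ->; last exact: (low1 2%N).
  apply: (@in_lower_cell_orb _ _ (1, 1, 0)); last exact: (low1 2%N).
  by apply: (@chart_tip R _ _ _ _ (-1)); rewrite rmorphN1; lra.
- case: yk => ->; last by rewrite (_ : (1 + 1) / 2 = 1); [apply: tip_in_lower|]; lra.
  rewrite addNr mul0r; apply: (@in_lower_cell_orb _ _ (0, 1, 0)).
    by rewrite chart_axis; apply: heis_orb_sym; exact: zero_axis.
  by apply: edge_in_lower; lra.
- case: yk => ->; last by apply: edge_in_lower; lra.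
  by apply: in_lower_cell_orb (chart_flip _ _) _; apply: edge_in_lower; lra.
- case: yk => ->; last first.
    by rewrite (_ : (1 + 1) / 2 / 2 = 2^-1); [apply: half_in_lower|]; lra.
  rewrite addNr !mul0r; apply: in_lower_cell_orb (zero_axis _) _.
  by apply: axis_in_lower; lra.
- case: yk => ->; first by rewrite addNr !mul0r; apply: edge_in_lower; lra.
  rewrite [X in (_, _, X)](_ : _ = 1); last by lra.
  by apply: in_lower_cell_orb (chart_1_0 _ _) _; apply: edge_in_lower; lra.
- case: yk => ->; first by rewrite addNr mul0r addr0 mul1r; apply: half_in_lower; lra.
  rewrite (_ : (1 + (1 + 1) / 2) / 2 = 1); last by lra.
  set h := (y 1%N + 1) / 2.
  (* The height [h] over the tip is traded for [s]: k - 1 < 4h <= k puts 8h + 1 - 2k into ]-1,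
     1]. *)
  have [k0 k1] := andP (ceil_itv (4 * h)); set k := Num.ceil _ in k0 k1.
  rewrite intrD rmorphN1 in k0.
  apply: (@in_lower_cell_orb _ _ (1, 8 * h + 1 - k%:~R * 2, 0)).
    by apply: (@chart_tip R _ _ _ _ k); lra.
  by apply: tip_in_lower; apply/andP; split; lra.
- case: yk => ->; first by rewrite addNr !mul0r; apply: edge_in_lower; lra.
  rewrite [X in (_, _, X)](_ : _ = 1); last by lra.
  by apply: in_lower_cell_orb (chart_1_0 _ _) _; apply: edge_in_lower; lra.
- by apply: cube_boundary_in_lower; try (apply/andP; split); case: yk => yk; lra.
- by apply: cube_boundary_in_lower; try (apply/andP; split); case: yk => yk; lra.
- by apply: cube_boundary_in_lower; try (apply/andP; split); case: yk => yk; lra.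
Qed.

End HeisCells.

(** * The equivariant CW structure on the Heisenberg group *)

Section HeisComplex.
Context (R : realType).
Local Notation act := (@heis_act R).

(** Rows of any length become sequences, so that [cell] has one argument type in all dimensions; 0
    is the default beyond the length. *)
Definition row_seq n (x : 'rV[R]_n) (k : nat) : R :=
  if insub k : option 'I_n is Some i then x ord0 i else 0.

Lemma row_seqE n (x : 'rV[R]_n) (i : 'I_n) : row_seq x i = x ord0 i.
Proof. by rewrite /row_seq valK. Qed.

Lemma row_seq_row n (y : nat -> R) k : (k < n)%N -> row_seq (\row_(i < n) y i) k = y k.
Proof. by move=> kn; rewrite -[k]/(val (Ordinal kn)) row_seqE mxE. Qed.

Lemma row_seq_continuous n k : continuous (fun x : 'rV[R]_n => row_seq x k).
Proof.
by rewrite /row_seq; case: insubP => [i _ _|_]; [exact: coord_continuous|exact: cst_continuous].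
Qed.

Definition cube_point n (x : 'rV[R]_n) : nat -> R := row_seq (disk_to_cube x).

Lemma cube_point_le n (x : 'rV[R]_n) k : (k < n)%N -> `|cube_point x k| <= norm2 x.
Proof.
move=> kn; rewrite -norm_disk_to_cube /cube_point -[k]/(val (Ordinal kn)) row_seqE.
exact: coord_le_norm.
Qed.

Lemma cube_point_closed n (x : 'rV[R]_n) : norm2 x <= 1 -> closed_cube n (cube_point x).
Proof.
by move=> x1 k kn; apply/andP; rewrite -ler_norml (le_trans (cube_point_le x kn)).
Qed.

Lemma cube_point_open n (x : 'rV[R]_n) : norm2 x < 1 -> open_cube n (cube_point x).
Proof.
by move=> x1 k kn; apply/andP; rewrite -ltr_norml (le_lt_trans (cube_point_le x kn)).
Qed.

Lemma cube_point_inj n (x x' : 'rV[R]_n) :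
  (forall k, (k < n)%N -> cube_point x k = cube_point x' k) -> x = x'.
Proof.
move=> E; apply: disk_to_cube_inj; apply/rowP => i.
by have := E i (ltn_ord i); rewrite /cube_point !row_seqE.
Qed.

Lemma cube_point_onto n (y : nat -> R) : closed_cube n y ->
  exists x : 'rV[R]_n, norm2 x <= 1 /\ forall k, (k < n)%N -> cube_point x k = y k.
Proof.
move=> yn; have [x xE] := disk_to_cube_surj (\row_(i < n) y i).
exists x; split=> [|k kn]; last by rewrite /cube_point xE row_seq_row.
rewrite -norm_disk_to_cube xE; have [->|r0] := eqVneq (\row_(i < n) y i) 0.
  by rewrite normr0 ler01.
have [i <-] := norm_attained r0; rewrite mxE ler_norml.
by have [-> ->] := yn i (ltn_ord i).
Qed.

Definition heis_cell n (i : 'I_(cell_count n)) (x : 'rV[R]_n) : heis R :=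
  chart (cell n i (cube_point x)).

Lemma cell_ext n i (y y' : nat -> R) : (i < cell_count n)%N ->
  (forall k, (k < n)%N -> y k = y' k) -> cell n i y = cell n i y'.
Proof.
move: n i; apply: in_cells => E /=.
all: rewrite ?(E 0%N isT) ?(E 1%N isT) ?(E 2%N isT)//.
Qed.

Lemma cell_in_cube n i (y : nat -> R) : (i < cell_count n)%N -> closed_cube n y ->
  chart_cube (cell n i y).
Proof.
move: n i; apply: in_cells => yn.
all: try have [y0 y0'] := yn 0%N isT; try have [y1 y1'] := yn 1%N isT;
  try have [y2 y2'] := yn 2%N isT.
all: by split=> /=; lra.
Qed.

Lemma heis_cell_continuous n (i : 'I_(cell_count n)) :
  {within unit_disk R n, continuous (heis_cell i)}.
Proof.
apply: continuous_subspaceT => x.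
apply: (@continuous_comp _ _ _ (fun x => cell n i (cube_point x))); last exact: chart_continuous.
apply: cell_continuous => // k {}x.
apply: (@continuous_comp _ _ _ (@disk_to_cube R n) (fun z => row_seq z k)).
  exact: disk_to_cube_continuous.
exact: row_seq_continuous.
Qed.

Theorem heis_GCW_complex : is_GCW_complex R (heis_action R).
Proof.
apply: (@cells_GCW_complex R _ _ (heis_action R) (fun n => 'I_(cell_count n)) heis_cell).
- exact: heis_hausdorff.
- exact: heis_cell_continuous.
- move=> n i j g x y x1 y1 E.
  have xc := cube_point_open x1; have yc := cube_point_open y1.
  have si := cell_strict (ltn_ord i) xc; have sj := cell_strict (ltn_ord j) yc.
  have Ki := cell_ofK (ltn_ord i) xc; have Kj := cell_ofK (ltn_ord j) yc.
  move: E; rewrite [heis_action R g _]/(act g _) /heis_cell.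
  case Ei : (cell n i _) si Ki => [[t s] v] si Ki.
  case Ej : (cell n j _) sj Kj => [[t' s'] v'] sj Kj E.
  have [cE fixg g1] := strict_chart_orbit si sj E.
  (* Equal strict parameters have the same [cell_of], hence the same index. *)
  have ij : i = j by apply: val_inj; move: Ki Kj; rewrite cE => -> [].
  subst j; split=> //; last by move=> z _; exact: cell_fixed Ei fixg g1 _.
  by apply: cube_point_inj; apply: (@cell_inj R n i); rewrite ?ltn_ord// Ei Ej.
- move=> m n i j g x y mn x1 y1 E.
  have xc := cube_point_open x1; have yc := cube_point_open y1.
  have si := cell_strict (ltn_ord i) xc; have sj := cell_strict (ltn_ord j) yc.
  have Ki := cell_ofK (ltn_ord i) xc; have Kj := cell_ofK (ltn_ord j) yc.
  move: E; rewrite [heis_action R g _]/(act g _) /heis_cell.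
  case Ei : (cell m i _) si Ki => [[t s] v] si Ki.
  case Ej : (cell n j _) sj Kj => [[t' s'] v'] sj Kj E.
  have [cE _ _] := strict_chart_orbit si sj E.
  by move: Kj; rewrite cE Ki => -[mn' _]; rewrite mn' ltnn in mn.
- move=> n i x x1.
  have [k [kn xk]] : exists k : nat, (k < n)%N /\ `|cube_point x k| = 1.
    have r0 : disk_to_cube x != 0 by rewrite -normr_eq0 norm_disk_to_cube x1 oner_eq0.
    have [k kE] := norm_attained r0; exists k; split=> //.
    by rewrite /cube_point row_seqE kE norm_disk_to_cube.
  have xc : closed_cube n (cube_point x) by apply: cube_point_closed; rewrite x1.
  have [m [j [y [mn jm yc [g gE]]]]] :=
    cell_boundary (ltn_ord i) xc (ex_intro _ k (conj kn xk)).
  have [z [z1 zE]] := cube_point_onto yc.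
  exists m, (Ordinal jm), g, z; split=> //.
  by rewrite [LHS]gE /heis_cell (cell_ext jm zE).
(* The translates of the closed 3-cell already cover everything; [t] and [v] are rescaled from
   [0, 1] to [-1, 1]. *)
- move=> p; have [t [s [v [ht hs hv [g ->]]]]] := chart_cover p.
  have yc : closed_cube 3 (fun k => nth 0 [:: 2 * t - 1; s; 2 * v - 1] k).
    by case=> [|[|[|//]]] _ /=; lra.
  have [x [x1 xE]] := cube_point_onto yc.
  exists 3%N, ord0, g, x; split=> //.
  rewrite [RHS]/(act g _) /heis_cell (@cell_ext 3 0 _ _ isT xE) /=.
  by congr (act g (chart (_, _, _))); lra.
- exists 4%N => n n4 [i]; rewrite /cell_count nth_default//.
- move=> p; have [U pU fin] := chart_cube_locally_finite p; exists U => // n i.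
  apply: sub_finite_set fin => g [q [Uq [x /unit_diskE x1 xq]]].
  exists q; split=> //; exists (heis_cell i x) => //.
  exists (cell n i (cube_point x)) => //; apply: cell_in_cube => //.
  exact: cube_point_closed.
Qed.

End HeisComplex.

(** * Orbit spaces *)

Section OrbitSpaceHomeo.
Context (G : groupType) (X Y T : topologicalType) (a : gaction G X).
Context (x0 : X) (C : set T) (k : T -> X) (f : T -> Y).
Hypothesis X_hausdorff : hausdorff_space X.
Hypothesis Y_hausdorff : hausdorff_space Y.
Hypothesis C_compact : compact C.
Hypothesis k_continuous : continuous k.
Hypothesis f_continuous : continuous f.
Hypothesis k_cover : forall x, exists c g, C c /\ x = a g (k c).
Hypothesis k_locally_finite : forall x : X, exists2 U, nbhs x U &
  finite_set [set g | (U `&` a g @` (k @` C)) !=set0].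
Hypothesis k_orbit : forall c c', C c -> C c' ->
  (exists g, k c = a g (k c')) <-> f c = f c'.

Let Q := orbit_space a.
Let piQ (x : X) : Q := \pi_Q%qT x.

Let piQ_eq x y : piQ x = piQ y <-> exists g, x = a g y.
Proof.
split=> [/eqquotP/asboolP[g ->]|[g ->]].
  by exists g^-1%g; rewrite -gactM mulVg gact1.
by apply/eqquotP/asboolP; exists g^-1%g; rewrite -gactM mulVg gact1.
Qed.

Let piQ_continuous : continuous piQ.
Proof. exact: (@pi_continuous X). Qed.

Let rep x := projT1 (cid (k_cover x)).
Let repP x : exists g, C (rep x) /\ x = a g (k (rep x)).
Proof. exact: projT2 (cid (k_cover x)). Qed.

Let F x := f (rep x).

Let FE g c : C c -> F (a g (k c)) = f c.
Proof.
move=> Cc; have [h [Cr E]] := repP (a g (k c)).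
apply/esym/k_orbit => //; exists (g^-1 * h)%g.
by rewrite gactM -E -gactM mulVg gact1.
Qed.

(** The translates of the image of [C] are a locally finite cover by compact images, and on each of
    them [F] becomes [f] in the parameter. *)
Let F_continuous : continuous F.
Proof.
apply/continuous_subspace_setT.
have -> : [set: X] = \bigcup_(g in [set: G]) (a g \o k) @` C.
  apply/seteqP; split=> // x _; have [c [g [Cc ->]]] := k_cover x.
  by exists g => //; exists c.
have kc (g : G) : {within C, continuous (a g \o k)}.
  apply: continuous_subspaceT => c.
  exact: (continuous_comp (@k_continuous c) (@gact_continuous _ _ a g _)).
apply: (@glue_continuous X Y G _ (fun=> T)) => //.
- move=> x; have [U xU fin] := k_locally_finite x; exists U => //.
  apply: sub_finite_set fin => g [_ [y [Uy [c Cc E]]]].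
  by exists y; split=> //; exists (k c) => //; exists c.
- move=> g _; apply: (@subspace_eq_continuous _ _ _ f).
    by move=> c /set_mem Cc; rewrite -[RHS]/(F (a g (k c))) FE.
  exact: continuous_subspaceT.
Qed.

(** The inverse map, with [x0] as default outside the image of [f]. By [k_orbit] the orbit does not
    depend on the chosen preimage. *)
Let w y : Q := piQ (xget x0 [set x | exists2 c, C c & x = k c /\ f c = y]).

Let wE c : C c -> w (f c) = piQ (k c).
Proof.
move=> Cc; rewrite /w; set P := [set x | _].
have [c' Cc' [-> fE]] : P (xget x0 P) by apply: xgetPex; exists (k c), c.
by apply/piQ_eq/k_orbit.
Qed.

Let w_continuous : {within f @` C, continuous w}.
Proof.
(* As a family with one member, the image of the compact set [C] falls under the gluing lemma, so
   continuity of [w] can be checked after composing with [f]. *)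
have -> : f @` C = \bigcup_(j in [set: unit]) f @` C.
  by rewrite bigcup_const//; exists tt.
apply: (@glue_continuous Y Q unit _ (fun=> T)) => //.
- by move=> _ _; exact: continuous_subspaceT.
- by move=> y; exists setT; [exact: filterT|exact: finite_finset].
- move=> _ _; apply: (@subspace_eq_continuous _ _ _ (piQ \o k)).
    by move=> c /set_mem Cc; rewrite -[RHS]/(w (f c)) wE.
  apply: continuous_subspaceT => c.
  exact: (continuous_comp (@k_continuous c) (@piQ_continuous _)).
Qed.

(** Both spaces are quotients of [C] by the same relation, expressed by [k_orbit]; [F] and [w]
    induce the mutually inverse maps. *)
Lemma orbit_space_homeomorphic : homeomorphic Q (set_type (f @` C)).
Proof.
have FS x : F x \in f @` C.
  by apply/mem_set; exists (rep x) => //; have [g []] := repP x.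
pose p (z : Q) : set_type (f @` C) := exist _ (F (repr z)) (FS (repr z)).
have pE x : p (piQ x) = exist _ (F x) (FS x).
  apply: val_inj => /=; have [g E] : exists g, repr (piQ x) = a g x.
    by apply/piQ_eq; rewrite /piQ reprK.
  have [h [Cr xE]] := repP x.
  by rewrite E xE -gactM !FE.
exists p, (sigL (f @` C) w); split.
- apply/quotient_continuous; apply: continuous_comp_initial.
  rewrite (_ : _ \o _ = F); first exact: F_continuous.
  by apply/funext => x /=; rewrite -/(piQ x) pE.
- exact/subspace_sigL_continuousP/w_continuous.
- move=> z; rewrite -[z]reprK; set x := repr z; rewrite -/(piQ x) pE /sigL /=.
  have [h [Cr xE]] := repP x.
  by rewrite /F wE//; apply/piQ_eq; exists h^-1%g; rewrite {2}xE -gactM mulVg gact1.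
- move=> [y yS]; apply: val_inj; have [c Cc cE] := set_mem yS; subst y.
  rewrite -[LHS]/(val (p (w (f c)))) wE// pE.
  by have := FE 1%g Cc; rewrite gact1.
Qed.

End OrbitSpaceHomeo.

(** * Fixed sets of finite subgroups *)

Section FixedSets.
Context (R : realType).
Implicit Types (t : R) (p q : heis R) (g h : heis_Z4).
Local Notation act := (@heis_act R).

(** The action is affine in the coordinates (x, [heis_mid], z). *)
Definition heis_mid p : R := p.1.2 - p.1.1 * p.2 / 2.
Definition of_mid (x u z : R) : heis R := (x, u + x * z / 2, z).

Definition heis_line t p q : heis R := of_mid
  ((1 - t) * p.1.1 + t * q.1.1) ((1 - t) * heis_mid p + t * heis_mid q)
  ((1 - t) * p.2 + t * q.2).

Definition heis_mean (s : seq (heis R)) : heis R :=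
  let n := (size s)%:R in
  of_mid ((\sum_(p <- s) p.1.1) / n) ((\sum_(p <- s) heis_mid p) / n)
    ((\sum_(p <- s) p.2) / n).

Lemma heis_line0 p q : heis_line 0 p q = p.
Proof.
by case: p => [[x y] z]; rewrite /heis_line /of_mid /heis_mid /=; congr (_, _, _); field.
Qed.

Lemma heis_line1 p q : heis_line 1 p q = q.
Proof.
by case: q => [[x y] z]; rewrite /heis_line /of_mid /heis_mid /=; congr (_, _, _); field.
Qed.

Lemma heis_act_line g t p q :
  act g (heis_line t p q) = heis_line t (act g p) (act g q).
Proof.
case: p q => [[x y] z] [[x' y'] z']; rewrite /heis_line /of_mid /heis_mid.
have [a [b [c [] ->]]] := heis_Z4_cases g.
- by rewrite !heis_act_t0 /=; congr (_, _, _); field.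
- by rewrite !heis_act_t1 /=; congr (_, _, _); field.
- by rewrite !heis_act_t2 /=; congr (_, _, _); field.
- by rewrite !heis_act_t3 /=; congr (_, _, _); field.
Qed.

Lemma sum_affine (s : seq (heis R)) (f : heis R -> R) (k a b c : R) :
  (forall p, f p = k + a * p.1.1 + b * heis_mid p + c * p.2) ->
  \sum_(p <- s) f p = k * (size s)%:R + a * (\sum_(p <- s) p.1.1) +
    b * (\sum_(p <- s) heis_mid p) + c * (\sum_(p <- s) p.2).
Proof.
move=> fE; rewrite (eq_bigr _ (fun p _ => fE p)); do 3 rewrite big_split /=.
rewrite -!mulr_sumr; congr (_ + _ + _ + _).
by rewrite big_const_seq count_predT iter_addr_0 mulr_natr.
Qed.

(** Affine maps commute with means; each use of [sum_affine] supplies the coefficients of one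
    coordinate of the action. *)
Lemma heis_act_mean g s : s != [::] -> act g (heis_mean s) = heis_mean (map (act g) s).
Proof.
move=> s0; have n0 : (size s)%:R != 0 :> R by rewrite pnatr_eq0 size_eq0.
rewrite /heis_mean size_map !big_map /of_mid.
have [a [b [c [] ->]]] := heis_Z4_cases g.
- rewrite (@sum_affine s (fun p => (act _ p).1.1) a%:~R 1 0 0); last first.
    by move=> [[x y] z]; rewrite heis_act_t0 /=; ring.
  rewrite (@sum_affine s (fun p => (act _ p).2) c%:~R 0 0 1); last first.
    by move=> [[x y] z]; rewrite heis_act_t0 /=; ring.
  rewrite (@sum_affine s (fun p => heis_mid (act _ p))
    (b%:~R - a%:~R * c%:~R / 2) (- c%:~R / 2) 1 (a%:~R / 2)); last first.
    by move=> [[x y] z]; rewrite heis_act_t0 /heis_mid /=; field.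
  by rewrite heis_act_t0; congr (_, _, _); field.
- rewrite (@sum_affine s (fun p => (act _ p).1.1) a%:~R 0 0 (-1)); last first.
    by move=> [[x y] z]; rewrite heis_act_t1 /=; ring.
  rewrite (@sum_affine s (fun p => (act _ p).2) c%:~R 1 0 0); last first.
    by move=> [[x y] z]; rewrite heis_act_t1 /=; ring.
  rewrite (@sum_affine s (fun p => heis_mid (act _ p))
    (b%:~R - a%:~R * c%:~R / 2) (a%:~R / 2) 1 (c%:~R / 2)); last first.
    by move=> [[x y] z]; rewrite heis_act_t1 /heis_mid /=; field.
  by rewrite heis_act_t1; congr (_, _, _); field.
- rewrite (@sum_affine s (fun p => (act _ p).1.1) a%:~R (-1) 0 0); last first.
    by move=> [[x y] z]; rewrite heis_act_t2 /=; ring.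
  rewrite (@sum_affine s (fun p => (act _ p).2) c%:~R 0 0 (-1)); last first.
    by move=> [[x y] z]; rewrite heis_act_t2 /=; ring.
  rewrite (@sum_affine s (fun p => heis_mid (act _ p))
    (b%:~R - a%:~R * c%:~R / 2) (c%:~R / 2) 1 (- a%:~R / 2)); last first.
    by move=> [[x y] z]; rewrite heis_act_t2 /heis_mid /=; field.
  by rewrite heis_act_t2; congr (_, _, _); field.
- rewrite (@sum_affine s (fun p => (act _ p).1.1) a%:~R 0 0 1); last first.
    by move=> [[x y] z]; rewrite heis_act_t3 /=; ring.
  rewrite (@sum_affine s (fun p => (act _ p).2) c%:~R (-1) 0 0); last first.
    by move=> [[x y] z]; rewrite heis_act_t3 /=; ring.
  rewrite (@sum_affine s (fun p => heis_mid (act _ p))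
    (b%:~R - a%:~R * c%:~R / 2) (- a%:~R / 2) 1 (- c%:~R / 2)); last first.
    by move=> [[x y] z]; rewrite heis_act_t3 /heis_mid /=; field.
  by rewrite heis_act_t3; congr (_, _, _); field.
Qed.

Lemma heis_mean_perm s s' : perm_eq s s' -> heis_mean s = heis_mean s'.
Proof.
by move=> ss'; rewrite /heis_mean (perm_size ss') !(perm_big s' ss').
Qed.

Lemma finite_subgroup_fixed_point (H : {pred heis_Z4}) :
  group_closed H -> finite_set [set` H] -> exists p, fixed_set (heis_action R) H p.
Proof.
move=> [H1 Hdiv] Hfin.
have HM g h : g \in H -> h \in H -> (g * h)%g \in H.
  move=> gH hH; rewrite -[h]invgK; apply: (Hdiv) => //.
  by rewrite -[h^-1%g]mul1g; exact: Hdiv.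
have [hs0' hsE'] := (finite_seqP _).1 Hfin; pose hs := undup hs0'.
have hsE g : (g \in hs) = (g \in H).
  rewrite mem_undup; have := congr1 (fun A : set heis_Z4 => A g) hsE'.
  by rewrite /mkset => E; apply/idP/idP; rewrite E.
exists (heis_mean [seq act h 1%g | h <- hs]) => g gH.
have hs0 : [seq act h 1%g | h <- hs] != [::].
  by rewrite -size_eq0 size_map size_eq0; apply: contraL H1 => /eqP E; rewrite -hsE E.
rewrite -[LHS]/(act g _) heis_act_mean// -map_comp.
rewrite (eq_map (g := (fun h => act h 1%g) \o (fun h => (g * h)%g))); last first.
  by move=> h; rewrite /= heis_actM.
(* Left multiplication by [g] permutes the repetition-free list of [H], hence preserves the mean of
   the orbit of the identity. *)
rewrite map_comp; apply/heis_mean_perm/perm_map.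
have uhs : uniq hs by exact: undup_uniq.
apply: uniq_perm => //; first by rewrite map_inj_uniq//; exact: mulgI.
move=> h; apply/mapP/idP => [[k]|]; rewrite hsE => kH; first by move=> ->; rewrite hsE HM.
exists (g^-1 * h)%g; last by rewrite mulVKg.
by rewrite hsE HM// -[g^-1%g]mul1g Hdiv.
Qed.

(** The contraction moves each point along its affine segment to the fixed point [p0]; by affinity
    the segment between two fixed points is fixed. *)
Lemma fixed_set_contractible (H : {pred heis_Z4}) :
  group_closed H -> finite_set [set` H] ->
  contractible R (set_type (fixed_set (heis_action R) H)).
Proof.
move=> Hg Hfin; set S := fixed_set _ H.
have [p0 p0S] := finite_subgroup_fixed_point Hg Hfin.
have line_S t p : S p -> heis_line t p p0 \in S.
  move=> pS; apply/mem_set => h hH.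
  by rewrite -[LHS]/(act h _) heis_act_line [act h p]pS// [act h p0]p0S.
have lineP t (p : set_type S) : heis_line t (set_val p) p0 \in S.
  by apply: line_S; apply: set_mem; exact: valP.
exists (exist (fun p => p \in S) p0 (mem_set p0S)).
exists (fun tp => exist (fun p => p \in S) _ (lineP tp.1 tp.2)); split.
- apply: continuous_subspaceT; apply: continuous_comp_initial.
  have c1 : continuous (fun tp : R * set_type S => tp.1) by move=> x; exact: cvg_fst.
  have cv : continuous (fun tp : R * set_type S => set_val tp.2 : heis R).
    by move=> x; apply: continuous_comp; [exact: cvg_snd|exact: initial_continuous].
  have cx : continuous (fun tp : R * set_type S => (set_val tp.2 : heis R).1.1).
    by move=> x; exact: (continuous_comp (cv x) (@heis_coord1_continuous R _)).
  have cy : continuous (fun tp : R * set_type S => (set_val tp.2 : heis R).1.2).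
    by move=> x; exact: (continuous_comp (cv x) (@heis_coord2_continuous R _)).
  have cz : continuous (fun tp : R * set_type S => (set_val tp.2 : heis R).2).
    by move=> x; exact: (continuous_comp (cv x) (@heis_coord3_continuous R _)).
  rewrite /comp /= /heis_line /of_mid /heis_mid.
  by apply: continuous_pair; [apply: continuous_pair|]; continuity.
- by move=> [p pS]; apply: val_inj; exact: heis_line0.
- by move=> [p pS]; apply: val_inj; exact: heis_line1.
Qed.

End FixedSets.

Theorem lemma2p4 (R : realType) :
  is_model_for_EG R (heis_action R) /\
  homeomorphic (orbit_space (heis_action R)) (set_type (unit_sphere R 4)).
Proof.
split; first split.
- exact: heis_GCW_complex.
- exact: heis_isotropy_finite.
- exact: fixed_set_contractible.
have -> : unit_sphere R 4 = @sphere_map R @` @chart_cube R.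
  apply/seteqP; split=> [u /sphere_map_onto[t [s [v [ht hs hv <-]]]]|_ [[[t s] v] [ht _ _] <-]].
    by exists (t, s, v).
  exact: sphere_map_sphere.
apply: (@orbit_space_homeomorphic _ _ _ _ (heis_action R) (0, 0, 0) _ (@chart R)).
- exact: heis_hausdorff.
- exact: norm_hausdorff.
- exact: chart_cube_compact.
- exact: chart_continuous.
- exact: sphere_map_continuous.
- by move=> p; have [t [s [v [? ? ? [g ->]]]]] := chart_cover p; exists (t, s, v), g.
- exact: chart_cube_locally_finite.
- by move=> [[t s] v] [[t' s'] v'] [ht hs _] [ht' hs' _]; exact: sphere_map_orbP.
Qed.
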